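(* For each $n\ge 2$ let $\pi$ be a uniformly random permutation in $S_n$, and define $$X_n=\frac{\mathrm{inv}(\pi)-m_n}{\sigma_n},\qquad Y_n=\frac{\mathrm{maj}(\pi)-m_n}{\sigma_n},$$ where $m_n=n(n-1)/4$ and $\sigma_n^2=\frac{2n^3+3n^2-5n}{72}$. Then for all real $s,t$, $$\lim_{n\to\infty}\Pr(X_n\le s,\ Y_n\le t)=\frac{1}{2\pi}\int_{-\infty}^{s}\int_{-\infty}^{t}e^{-x^2/2-y^2/2}\,dy\,dx .$$ That is, $(X_n,Y_n)$ converges in distribution to a pair of independent standard normal random variables. *)

(* Defs.v *)
From Stdlib Require Import Reals.
From mathcomp Require Import all_boot all_fingroup.

Set Implicit Arguments.
Unset Strict Implicit.
Unset Printing Implicit Defensive.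

(* value of the permutation at (0-indexed) position k, as a nat; 0 outside range *)
Definition pval (n : nat) (p : {perm 'I_n}) (k : nat) : nat :=
  oapp (fun i : 'I_n => nat_of_ord (p i)) 0%N (insub k).

Definition inv_perm (n : nat) (p : {perm 'I_n}) : nat :=
  (\sum_(i < n) \sum_(j < n) ((i < j) && (p j < p i)))%N.

(* major index: sum of the (1-indexed) descent positions d with p(d) > p(d+1).
   With 0-indexed positions, a descent at i (i+1 < n) contributes i+1. *)
Definition maj_perm (n : nat) (p : {perm 'I_n}) : nat :=
  (\sum_(0 <= i < n.-1) (if pval p i.+1 < pval p i then i.+1 else 0))%N.

Local Open Scope R_scope.

Definition mean_n (n : nat) : R := INR n * (INR n - 1) / 4.
Definition sigma_n (n : nat) : R :=
  sqrt ((2 * INR n ^ 3 + 3 * INR n ^ 2 - 5 * INR n) / 72).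

Definition Xn (n : nat) (p : {perm 'I_n}) : R :=
  ((INR (inv_perm p) - mean_n n) / sigma_n n).
Definition Yn (n : nat) (p : {perm 'I_n}) : R :=
  ((INR (maj_perm p) - mean_n n) / sigma_n n).

Definition Rleb (x y : R) : bool := if Rle_dec x y then true else false.

Definition joint_prob (n : nat) (s t : R) : R :=
  (INR #|[set p : {perm 'I_n} | Rleb (Xn p) s && Rleb (Yn p) t]|
   / INR #|{perm 'I_n}|).

Definition std_normal_density (x : R) : R := (exp (- x ^ 2 / 2) / sqrt (2 * PI)).

Definition is_std_normal_cdf (s l : R) : Prop :=
  forall eps : R, (eps > 0) -> exists A : R, forall a : R, (a <= A) ->
    exists pr : Riemann_integrable std_normal_density a s,
      (Rabs (RiemannInt pr - l) < eps).

(* Main.v *)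
(** Write [c_k] for the number of earlier entries exceeding the [k]-th entry of a
permutation. The [c_k] are independent, [c_k] is uniform on [{0, ..., k-1}], the sum of
the [c_k] is [inv], and [k] is a descent iff [c_(k+1) > c_k]. Hence the residue [w_k] of
[c_k - c_(k+1)] modulo [k+1] is uniform on [{0, ..., k}] given [c_1, ..., c_k], and the sum
of the [w_k] is [maj + des - c_n], which differs from [maj] by at most [n], negligible
against [sigma_n]. The two centred processes built from [c_(k+1)] and [w_k] have increments
of equal variance, adding up exactly to [sigma_n ^ 2]; the conditional covariance of the two
increments is of order [k ^ 2] but its mean over [c_k] is only of order [k]. A Lindeberg
telescoping along the solution [Phi (- z / sqrt tau)] of the heat equation, which for small
[tau] is a smoothed indicator of a half-line, gives the limit law with independent
coordinates. *)
Require Import Defs.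
From Stdlib Require Import Reals Lra Psatz.
From HB Require Import structures.
From mathcomp Require Import all_boot all_fingroup zify.
From Coquelicot Require Import Coquelicot.

Local Open Scope R_scope.
(** * The Gaussian integral *)

Definition gauss (x : R) : R := exp (- x ^ 2 / 2).

Lemma continuous_gauss x : continuous gauss x.
Proof. apply: ex_derive_continuous; rewrite /gauss; auto_derive; lra. Qed.

Lemma ex_RInt_gauss a b : ex_RInt gauss a b.
Proof. apply: ex_RInt_continuous => z _; exact: continuous_gauss. Qed.

Lemma gauss_pos x : 0 < gauss x.
Proof. exact: exp_pos. Qed.

(* The derivative in [x] of its integral over [0, 1] is minus that of [(RInt gauss 0 x) ^ 2]. *)
Definition gauss_arc (x t : R) : R := 2 * exp (- x ^ 2 * (1 + t ^ 2) / 2) / (1 + t ^ 2).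

Lemma gauss_arc_den t : 1 + t ^ 2 <> 0.
Proof. nra. Qed.

Lemma ex_RInt_gauss_arc x : ex_RInt (gauss_arc x) 0 1.
Proof.
apply: ex_RInt_continuous => z _.
apply: ex_derive_continuous; rewrite /gauss_arc; auto_derive.
have := gauss_arc_den z; simpl; lra.
Qed.

Lemma is_derive_gauss_int x : is_derive (fun x => RInt gauss 0 x) x (gauss x).
Proof.
apply: (is_derive_RInt _ _ 0) => //; last exact: continuous_gauss.
by exists (mkposreal _ Rlt_0_1) => y _; apply: RInt_correct; exact: ex_RInt_gauss.
Qed.

(** Differentiation under the integral sign; the substitution [u = x * t] turns the integral of the
    partial derivative into a multiple of [RInt gauss 0 x]. *)
Lemma is_derive_gauss_arc_int (x : R) :
  is_derive (fun x => RInt (gauss_arc x) 0 1) x (- (2 * gauss x * RInt gauss 0 x)).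
Proof.
have D y t : is_derive (fun u => gauss_arc u t) y (- 2 * y * exp (- y ^ 2 * (1 + t ^ 2) / 2)).
  rewrite /gauss_arc; auto_derive => //; have h := gauss_arc_den t.
  set e := exp _; field; lra.
have E : - (2 * gauss x * RInt gauss 0 x) =
   RInt (fun t => Derive (fun u => gauss_arc u t) x) 0 1.
  rewrite (RInt_ext (fun t => Derive (fun u => gauss_arc u t) x)
    (fun t => (- 2 * gauss x) * (x * gauss (x * t + 0)))); last first.
 move=> t _; rewrite (is_derive_unique _ _ _ (D x t)) /gauss.
    have -> : - x ^ 2 * (1 + t ^ 2) / 2 = - x ^ 2 / 2 + - (x * t + 0) ^ 2 / 2 by field.
    rewrite exp_plus.
    by match goal with |- @eq _ ?a ?b => change (@eq R a b) end; ring.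
  rewrite (RInt_scal (V := R_CompleteNormedModule)
      (fun t => x * gauss (x * t + 0)) 0 1 (- 2 * gauss x)); last first.
    apply: ex_RInt_continuous => z _; apply: ex_derive_continuous.
    rewrite /gauss; auto_derive => //.
  rewrite (RInt_comp_lin gauss x 0 0 1) ?Rmult_0_r ?Rmult_1_r ?Rplus_0_r //.
    by rewrite /scal /= /mult /=; ring.
  exact: ex_RInt_gauss.
apply: (eq_ind_r (is_derive _ x) _ E); apply: (is_derive_RInt_param gauss_arc).
- by exists (mkposreal _ Rlt_0_1) => y _ t _; eexists; exact: D.
- move=> t _.
  apply: (continuity_2d_pt_ext (fun y t => - 2 * y * exp (- y ^ 2 * (1 + t ^ 2) / 2))).
    by move=> a b; rewrite (is_derive_unique _ _ _ (D a b)).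
  apply: continuity_2d_pt_mult.
    apply: continuity_2d_pt_mult; [exact: continuity_2d_pt_const | exact: continuity_2d_pt_id1].
  apply: (continuity_1d_2d_pt_comp exp).
    by apply: derivable_continuous_pt; exact: derivable_pt_exp.
  apply: (continuity_2d_pt_ext (fun y t => (- 1 / 2) * (y * y * (1 + t * t)))).
    by move=> a b; field.
  apply: continuity_2d_pt_mult; first exact: continuity_2d_pt_const.
  apply: continuity_2d_pt_mult.
    by apply: continuity_2d_pt_mult; exact: continuity_2d_pt_id1.
  apply: continuity_2d_pt_plus; first exact: continuity_2d_pt_const.
  by apply: continuity_2d_pt_mult; exact: continuity_2d_pt_id2.
- by exists (mkposreal _ Rlt_0_1) => y _; exact: ex_RInt_gauss_arc.
Qed.

Lemma gauss_arc_int_0 : RInt (gauss_arc 0) 0 1 = PI / 2.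
Proof.
have -> : PI / 2 = 2 * (atan 1 - atan 0) by rewrite atan_1 atan_0; field.
apply: is_RInt_unique.
have -> : 2 * (atan 1 - atan 0) = minus (2 * atan 1) (2 * atan 0).
  by rewrite /minus /plus /opp /=; ring.
apply: (is_RInt_derive (fun t => 2 * atan t)) => t _.
  have h := gauss_arc_den t.
  have d : is_derive (fun t => 2 * atan t) t (2 * / (1 + t ^ 2)).
    apply: is_derive_scal; apply/is_derive_Reals.
    by have := derivable_pt_lim_atan t; rewrite /Rsqr /=; rewrite Rmult_1_r.
  rewrite /gauss_arc (_ : - 0 ^ 2 * (1 + t ^ 2) / 2 = 0); last by field.
  by rewrite exp_0 Rmult_1_r.
apply: ex_derive_continuous; rewrite /gauss_arc; auto_derive.
have := gauss_arc_den t; simpl; lra.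
Qed.

(** The derivatives of the two summands cancel, so the sum keeps its value at 0. As the second
    summand vanishes at infinity, this evaluates the Gaussian integral. *)
Lemma gauss_int_sqr x : RInt gauss 0 x ^ 2 + RInt (gauss_arc x) 0 1 = PI / 2.
Proof.
pose h := fun x => RInt gauss 0 x ^ 2 + RInt (gauss_arc x) 0 1.
have D y : is_derive h y 0.
  have -> : 0 = INR 2 * gauss y * RInt gauss 0 y ^ 1 + - (2 * gauss y * RInt gauss 0 y).
    by rewrite /=; ring.
  apply: (is_derive_plus (K := R_AbsRing)); last exact: is_derive_gauss_arc_int.
  exact: (is_derive_pow _ 2 _ _ (is_derive_gauss_int y)).
have E : h x = h 0.
  have [c [_ Hc]] := MVT_gen h 0 x (fun _ => 0) (fun y _ => D y)
    (fun y _ => proj2 (continuity_pt_filterlim _ _)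
      (ex_derive_continuous h y (ex_intro _ _ (D y)))).
  move: Hc; lra.
by rewrite -/(h x) E /h RInt_point gauss_arc_int_0 /zero /=; ring.
Qed.

Lemma exp_nondecreasing x y : x <= y -> exp x <= exp y.
Proof. by case=> [/exp_increasing/Rlt_le | ->] //; exact: Rle_refl. Qed.

Lemma gauss_arc_int_bounds x :
  0 <= RInt (gauss_arc x) 0 1 <= 2 * exp (- x ^ 2 / 2).
Proof.
have H t : 0 <= gauss_arc x t <= 2 * exp (- x ^ 2 / 2).
  rewrite /gauss_arc; have h : 1 <= 1 + t ^ 2 by nra.
  have e0 := exp_pos (- x ^ 2 * (1 + t ^ 2) / 2).
  have e1 : exp (- x ^ 2 * (1 + t ^ 2) / 2) <= exp (- x ^ 2 / 2) by apply: exp_nondecreasing; nra.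
  split; first by apply: Rlt_le; apply: Rdiv_lt_0_compat; lra.
  by apply/Rle_div_l; nra.
split.
  apply: RInt_ge_0; [lra | exact: ex_RInt_gauss_arc | by move=> t _; apply H].
have -> : 2 * exp (- x ^ 2 / 2) = RInt (fun _ => 2 * exp (- x ^ 2 / 2)) 0 1.
  by rewrite RInt_const /scal /= /mult /=; ring.
apply: RInt_le; [lra | exact: ex_RInt_gauss_arc | exact: ex_RInt_const | by move=> t _; apply H].
Qed.

Lemma exp_neg_le y : 0 <= y -> exp (- y) <= / (1 + y).
Proof.
move=> y0; rewrite exp_Ropp; apply: Rinv_le_contravar; first lra.
exact: exp_ineq1_le.
Qed.

Lemma gauss_int_lim eps : 0 < eps ->
  exists A, 0 < A /\ forall x, A <= x -> Rabs (RInt gauss 0 x - sqrt (PI / 2)) < eps.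
Proof.
move=> e0; exists (2 / eps + 1).
have p0 : 0 < 2 / eps by apply: Rdiv_lt_0_compat; lra.
split; first lra; move=> x Ax.
have [G0 G1] := gauss_arc_int_bounds x.
have E := gauss_int_sqr x.
have a0 : 0 <= RInt gauss 0 x.
  by apply: RInt_ge_0; [lra | exact: ex_RInt_gauss | move=> t _; apply: Rlt_le; exact: gauss_pos].
have pi2 : 1 <= PI / 2 by have := PI2_1; lra.
have c1 : 1 <= sqrt (PI / 2) by rewrite -sqrt_1; apply: sqrt_le_1; lra.
have cc : sqrt (PI / 2) * sqrt (PI / 2) = PI / 2 by apply: sqrt_sqrt; lra.
have ex : exp (- x ^ 2 / 2) <= / (1 + x ^ 2 / 2).
  have -> : - x ^ 2 / 2 = - (x ^ 2 / 2) by field.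
  apply: exp_neg_le; nra.
have ix : / (1 + x ^ 2 / 2) <= / x by apply: Rinv_le_contravar; nra.
have xe : 2 * / x < eps.
  have xx : 2 < eps * x.
    have : eps * (2 / eps + 1) = 2 + eps by field; lra.
    nra.
  by apply/Rlt_div_l; lra.
move: (RInt gauss 0 x) (sqrt (PI / 2)) (RInt (gauss_arc x) 0 1) (exp _) (/ x) (/ _)
   E a0 c1 cc G0 G1 ex ix xe => a c G ee ix ii *.
(* From [a ^ 2 + G = c ^ 2] with [G >= 0] and [c >= 1]: [c - a <= (c - a) * (c + a) = G < eps]. *)
have ca : a <= c by nra.
by split_Rabs; nra.
Qed.

(** * The standard normal distribution function, as one half plus a proper integral from 0 *)

Definition Phi (x : R) : R := 1 / 2 + RInt gauss 0 x / sqrt (2 * PI).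

Lemma sqrt_2PI_ge : 2 <= sqrt (2 * PI).
Proof.
have pi := PI2_1; have := sqrt_pos (2 * PI).
have : sqrt (2 * PI) * sqrt (2 * PI) = 2 * PI by apply: sqrt_sqrt; lra.
nra.
Qed.

Lemma sqrt_PI2 : sqrt (PI / 2) = sqrt (2 * PI) / 2.
Proof.
have pi := PI2_1.
apply: sqrt_lem_1; [lra | have := sqrt_2PI_ge; lra |].
have : sqrt (2 * PI) * sqrt (2 * PI) = 2 * PI by apply: sqrt_sqrt; lra.
lra.
Qed.

Lemma is_derive_Phi x : is_derive Phi x (std_normal_density x).
Proof.
have h := sqrt_2PI_ge.
rewrite /Phi.
have -> : std_normal_density x = 0 + / sqrt (2 * PI) * gauss x.
  by rewrite /std_normal_density /gauss /Rdiv; ring.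
apply: (is_derive_plus (K := R_AbsRing)); first exact: is_derive_const.
apply: (is_derive_ext (fun x => / sqrt (2 * PI) * RInt gauss 0 x)).
  by move=> t; rewrite Rmult_comm.
exact: is_derive_scal (is_derive_gauss_int x).
Qed.

Lemma density_bounds w :
  0 < std_normal_density w <= 1 /\ w ^ 2 * std_normal_density w <= 4.
Proof.
have h := sqrt_2PI_ge.
have e0 := exp_pos (- w ^ 2 / 2).
have e1 : exp (- w ^ 2 / 2) <= / (1 + w ^ 2 / 2).
  have -> : - w ^ 2 / 2 = - (w ^ 2 / 2) by field.
  apply: exp_neg_le; nra.
have e2 : exp (- w ^ 2 / 2) * (1 + w ^ 2 / 2) <= 1.
  apply: (Rle_trans _ (/ (1 + w ^ 2 / 2) * (1 + w ^ 2 / 2))).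
    by apply: Rmult_le_compat_r => //; nra.
  by right; field; nra.
have dg : std_normal_density w <= exp (- w ^ 2 / 2).
  rewrite /std_normal_density; apply/Rle_div_l; nra.
have d0 : 0 < std_normal_density w by apply: Rdiv_lt_0_compat; lra.
split; nra.
Qed.

(** With [e = exp (- w ^ 2 / 4)], the exponential is [e ^ 2] and the product splits into
    [e * Rabs w] and [e * Rabs w ^ 2], at most 1 and 4 by [exp_neg_le]. *)
Lemma density_cube w : Rabs w ^ 3 * std_normal_density w <= 4.
Proof.
have h := sqrt_2PI_ge.
have [[d0 _] _] := density_bounds w.
have e0 := exp_pos (- w ^ 2 / 4).
have e1 : exp (- w ^ 2 / 4) <= / (1 + w ^ 2 / 4).
  have -> : - w ^ 2 / 4 = - (w ^ 2 / 4) by field.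
  apply: exp_neg_le; nra.
have e2 : exp (- w ^ 2 / 4) * (1 + w ^ 2 / 4) <= 1.
  apply: (Rle_trans _ (/ (1 + w ^ 2 / 4) * (1 + w ^ 2 / 4))).
    by apply: Rmult_le_compat_r => //; nra.
  by right; field; nra.
have dg : std_normal_density w <= exp (- w ^ 2 / 4) ^ 2.
  have -> : exp (- w ^ 2 / 4) ^ 2 = exp (- w ^ 2 / 2).
    have -> : - w ^ 2 / 2 = - w ^ 2 / 4 + - w ^ 2 / 4 by field.
    by rewrite exp_plus; ring.
  rewrite /std_normal_density; apply/Rle_div_l; first lra.
  have := exp_pos (- w ^ 2 / 2); nra.
move: e0 e2 dg d0; rewrite -(pow2_abs w); move: (exp _) (std_normal_density w) (Rabs_pos w) => e d.
move: (Rabs w) => {h e1}w w0 e0 e2 dg d0.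
have e3 : e * w <= 1.
  have : w <= 1 + w ^ 2 / 4 by have := pow2_ge_0 (w / 2 - 1); lra.
  nra.
have e4 : e * w ^ 2 <= 4 by nra.
have : (e * w) * (e * w ^ 2) <= 4.
  have : 0 <= e * w by nra.
  have : 0 <= e * w ^ 2 by nra.
  nra.
have : w ^ 3 * d <= w ^ 3 * e ^ 2.
  by apply: Rmult_le_compat_l => //; apply: pow_le.
nra.
Qed.

Lemma Phi_opp x : Phi (- x) = 1 - Phi x.
Proof.
suff E : RInt gauss 0 (- x) = - RInt gauss 0 x.
  by rewrite /Phi E; lra.
have := RInt_comp_lin gauss (- 1) 0 0 x (ex_RInt_gauss _ _).
rewrite Rmult_0_r !Rplus_0_r (_ : - 1 * x = - x) => [<-|]; last ring.
rewrite (RInt_ext _ (fun y => opp (gauss y))); last first.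
  move=> y _; rewrite Rplus_0_r /gauss (_ : - (- 1 * y) ^ 2 / 2 = - y ^ 2 / 2); last field.
  by rewrite /scal /opp /= /mult /=; ring.
by rewrite RInt_opp //; exact: ex_RInt_gauss.
Qed.

Lemma Phi_bounds x : 0 <= Phi x <= 1.
Proof.
have h := sqrt_2PI_ge; have [G0 _] := gauss_arc_int_bounds x.
have E := gauss_int_sqr x.
have cc : sqrt (PI / 2) * sqrt (PI / 2) = PI / 2.
  by apply: sqrt_sqrt; have := PI2_1; lra.
rewrite sqrt_PI2 in cc.
have [l u] : - (sqrt (2 * PI) / 2) <= RInt gauss 0 x <= sqrt (2 * PI) / 2 by nra.
rewrite /Phi; split.
  have : - (1 / 2) <= RInt gauss 0 x / sqrt (2 * PI) by apply/Rle_div_r; lra.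
  lra.
have : RInt gauss 0 x / sqrt (2 * PI) <= 1 / 2 by apply/Rle_div_l; lra.
lra.
Qed.

Lemma MVT_R (f df : R -> R) a b : (forall x, is_derive f x (df x)) ->
  exists c, Rmin a b <= c <= Rmax a b /\ f b - f a = df c * (b - a).
Proof.
move=> D; apply: MVT_gen => x _; first exact: D.
apply/continuity_pt_filterlim; apply: (ex_derive_continuous f x); eexists; exact: D.
Qed.

Lemma Phi_le x y : x <= y -> Phi x <= Phi y.
Proof.
move=> xy; have [c [_ E]] := MVT_R Phi _ x y is_derive_Phi.
have [[d0 _] _] := density_bounds c; nra.
Qed.

Lemma Phi_lipschitz x y : Rabs (Phi x - Phi y) <= Rabs (x - y).
Proof.
have [c [_ E]] := MVT_R Phi _ y x is_derive_Phi.
have [[d0 d1] _] := density_bounds c; rewrite E Rabs_mult (Rabs_pos_eq _ (Rlt_le _ _ d0)).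
have := Rabs_pos (x - y); nra.
Qed.

Lemma Phi_lim eps : 0 < eps -> exists A, 0 < A /\ forall x, A <= x -> Phi (- x) < eps.
Proof.
move=> e0; have [A [A0 H]] := gauss_int_lim eps e0.
exists A; split=> // x /H; rewrite Phi_opp sqrt_PI2 /Phi.
move: (RInt _ _ _) (sqrt _) sqrt_2PI_ge => a c c2 /Rabs_def2[_ h].
have : 1 / 2 - eps < a / c by apply/Rlt_div_r; nra.
lra.
Qed.

(** The hypothesis describes the integral of the density from minus infinity, and [Phi] is an
    antiderivative that tends to 0 there. *)
Lemma std_normal_cdf_Phi s l : is_std_normal_cdf s l -> l = Phi s.
Proof.
move=> H; apply: cond_eq => eps e0.
have [A HA] := H (eps / 2) ltac:(lra).
have [B [_ HB]] := Phi_lim (eps / 2) ltac:(lra).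
have [pr] := HA (Rmin A (- B)) (Rmin_l _ _).
have := HB (- Rmin A (- B)) ltac:(have := Rmin_r A (- B); lra).
rewrite Ropp_involutive -RInt_Reals.
move: (Rmin A (- B)) => a.
have -> : RInt std_normal_density a s = Phi s - Phi a.
  apply: is_RInt_unique; apply: (is_RInt_derive Phi) => x _; first exact: is_derive_Phi.
  apply: ex_derive_continuous; rewrite /std_normal_density; auto_derive.
  by have := sqrt_2PI_ge; lra.
have := Phi_bounds a => *; split_Rabs; lra.
Qed.

(** * The heat equation *)

(** The probability that [z + sqrt tau * G] is at most 0 for a standard normal [G]. *)
Definition heat (tau z : R) : R := Phi (- z / sqrt tau).
(* [heat1], [heat2], [heat3] are the successive derivatives of [heat] in [z]; [heat4] is the
   derivative of [heat2] in [tau]. *)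
Definition heat1 (tau z : R) : R := - (std_normal_density (z / sqrt tau) / sqrt tau).
Definition heat2 (tau z : R) : R :=
  z * std_normal_density (z / sqrt tau) / (tau * sqrt tau).
Definition heat3 (tau z : R) : R :=
  (1 - (z / sqrt tau) ^ 2) * std_normal_density (z / sqrt tau) / (tau * sqrt tau).
Definition heat4 (tau z : R) : R :=
  ((z / sqrt tau) ^ 3 - 3 * (z / sqrt tau)) * std_normal_density (z / sqrt tau)
  / (2 * tau ^ 2).

Lemma density_opp w : std_normal_density (- w) = std_normal_density w.
Proof.
by rewrite /std_normal_density (_ : - (- w) ^ 2 / 2 = - w ^ 2 / 2); last field.
Qed.

Lemma is_derive_density w : is_derive std_normal_density w (- w * std_normal_density w).
Proof.
have h := sqrt_2PI_ge.
rewrite /std_normal_density; auto_derive; first lra.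
rewrite (_ : - (w * (w * 1)) * / 2 = - w ^ 2 / 2); last by field.
by field; lra.
Qed.

Lemma is_derive_heat_x tau z : 0 < tau -> is_derive (heat tau) z (heat1 tau z).
Proof.
move=> /sqrt_lt_R0 r0; rewrite /heat /heat1.
evar_last.
  apply: (is_derive_comp Phi (fun z => - z / sqrt tau)); first exact: is_derive_Phi.
  by auto_derive; [lra | reflexivity].
rewrite /scal /= /mult /=.
rewrite (_ : - z / sqrt tau = - (z / sqrt tau)); last by field; lra.
by rewrite density_opp; field; lra.
Qed.

Lemma is_derive_heat1_x tau z : 0 < tau -> is_derive (heat1 tau) z (heat2 tau z).
Proof.
move=> t0; have r0 := sqrt_lt_R0 _ t0; rewrite /heat1 /heat2.
evar_last.
  apply: is_derive_opp.
  apply: (is_derive_ext (fun z => / sqrt tau * std_normal_density (z / sqrt tau))).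
    by move=> t; rewrite /Rdiv Rmult_comm.
  apply: is_derive_scal.
  apply: (is_derive_comp std_normal_density (fun z => z / sqrt tau)).
    exact: is_derive_density.
  by auto_derive; [lra | reflexivity].
rewrite /scal /opp /= /mult /=.
have E : sqrt tau * sqrt tau = tau by apply: sqrt_sqrt; lra.
move: (sqrt tau) E r0 => r <- r0; by field; lra.
Qed.

Lemma is_derive_heat2_x tau z : 0 < tau -> is_derive (heat2 tau) z (heat3 tau z).
Proof.
move=> t0; have r0 := sqrt_lt_R0 _ t0; rewrite /heat2 /heat3.
evar_last.
  apply: (is_derive_ext (fun z => / (tau * sqrt tau) * (z * std_normal_density (z / sqrt tau)))).
    by move=> t; rewrite /Rdiv Rmult_comm.
  apply: is_derive_scal.
  apply: is_derive_mult.
  - exact: is_derive_id.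
  - apply: (is_derive_comp std_normal_density (fun z => z / sqrt tau)).
      exact: is_derive_density.
    by auto_derive; [lra | reflexivity].
  - exact: Rmult_comm.
rewrite /scal /plus /one /= /mult /=.
have E : sqrt tau * sqrt tau = tau by apply: sqrt_sqrt; lra.
move: (sqrt tau) E r0 => r <- r0; by field; lra.
Qed.

(** The heat equation, as [heat2] is the second derivative in [z]. Because of it, a shift of [tau]
    by [h] offsets increments of variance [h]. *)
Lemma is_derive_heat_t tau z : 0 < tau ->
  is_derive (fun tau => heat tau z) tau (heat2 tau z / 2).
Proof.
move=> t0; have r0 := sqrt_lt_R0 _ t0; rewrite /heat /heat2.
evar_last.
  apply: (is_derive_comp Phi (fun tau => - z / sqrt tau)); first exact: is_derive_Phi.
  by auto_derive; [ | reflexivity]; split=> //; lra.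
rewrite /scal /= /mult /=.
rewrite (_ : - z / sqrt tau = - (z / sqrt tau)); last by field; lra.
have E : sqrt tau * sqrt tau = tau by apply: sqrt_sqrt; lra.
by rewrite density_opp; move: (sqrt tau) E r0 => r <- r0; field; lra.
Qed.

Lemma is_derive_heat2_t tau z : 0 < tau ->
  is_derive (fun tau => heat2 tau z) tau (heat4 tau z).
Proof.
move=> t0; have r0 := sqrt_lt_R0 _ t0; rewrite /heat2 /heat4.
evar_last.
  apply: (is_derive_ext
    (fun tau => z / (tau * sqrt tau) * std_normal_density (z / sqrt tau))).
    by move=> t; rewrite /Rdiv; match goal with |- @eq _ ?a ?b => change (@eq R a b) end; ring.
  apply: is_derive_mult.
  - auto_derive; [ | reflexivity].
    by split=> //; split=> //; have := Rmult_lt_0_compat _ _ t0 r0; lra.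
  - apply: (is_derive_comp std_normal_density (fun tau => z / sqrt tau)).
      exact: is_derive_density.
    by auto_derive; [ | reflexivity]; split=> //; lra.
  - exact: Rmult_comm.
rewrite /scal /plus /one /= /mult /=.
have E : sqrt tau * sqrt tau = tau by apply: sqrt_sqrt; lra.
by move: (sqrt tau) E r0 => r <- r0; field; lra.
Qed.

(** * Taylor estimates for the heat solution, uniform for [tau] bounded below *)

Lemma MVT_abs (f df : R -> R) a b K :
  (forall x, Rmin a b <= x <= Rmax a b -> is_derive f x (df x) /\ Rabs (df x) <= K) ->
  Rabs (f b - f a) <= K * Rabs (b - a).
Proof.
move=> D.
have [||c [Hc ->]] := MVT_gen f a b df.
- by move=> x Hx; apply: (proj1 (D x _)); lra.
- move=> x Hx; apply/continuity_pt_filterlim; apply: (ex_derive_continuous f x).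
  by eexists; exact: (proj1 (D x Hx)).
rewrite Rabs_mult; apply: Rmult_le_compat_r; first exact: Rabs_pos.
exact: (proj2 (D c Hc)).
Qed.

(** The mean value inequality is applied twice, to [f1] minus its linear part and then to [f] minus
    its quadratic expansion; each use gains a factor [Rabs h]. *)
Lemma taylor2 (f f1 f2 : R -> R) K x h :
  (forall x, is_derive f x (f1 x)) -> (forall x, is_derive f1 x (f2 x)) ->
  (forall x y, Rabs (f2 x - f2 y) <= K * Rabs (x - y)) ->
  Rabs (f (x + h) - f x - f1 x * h - f2 x * h ^ 2 / 2) <= K * Rabs h ^ 3.
Proof.
move=> D1 D2 L.
have K0 : 0 <= K.
  have := Rle_trans _ _ _ (Rabs_pos _) (L 1 0); rewrite Rminus_0_r Rabs_R1; lra.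
have le u : Rmin 0 h <= u <= Rmax 0 h -> Rabs u <= Rabs h.
  by rewrite /Rmin /Rmax; case: Rle_dec => ?; split_Rabs; lra.
have shift (g dg : R -> R) (u : R) : (forall x, is_derive g x (dg x)) ->
    is_derive (fun u => g (x + u)) u (dg (x + u)).
  move=> Dg; evar_last.
    by apply: (is_derive_comp g (fun u => x + u)); [exact: Dg | auto_derive].
  by rewrite /scal /= /mult /=; ring.
have B1 u : Rmin 0 h <= u <= Rmax 0 h -> Rabs (f1 (x + u) - f1 x - f2 x * u) <= K * Rabs h ^ 2.
  move=> hu.
  have L1 w : Rmin 0 u <= w <= Rmax 0 u ->
      is_derive (fun u => f1 (x + u) - f2 x * u) w (f2 (x + w) - f2 x)
      /\ Rabs (f2 (x + w) - f2 x) <= K * Rabs h.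
    move=> hw; split.
      apply: (is_derive_minus (K := R_AbsRing)); first exact: (shift f1 f2).
      by auto_derive => //; ring.
    apply: Rle_trans (L _ _) _; apply: Rmult_le_compat_l => //.
    rewrite (_ : x + w - x = w); last ring.
    apply: le; move: hu hw; rewrite /Rmin /Rmax; do 2 case: Rle_dec => ?; lra.
  have := MVT_abs _ _ 0 u _ L1.
  have := le u hu; have := Rabs_pos u; have := Rabs_pos h.
  rewrite !Rplus_0_r Rmult_0_r !Rminus_0_r.
  rewrite (_ : f1 (x + u) - f2 x * u - f1 x = f1 (x + u) - f1 x - f2 x * u); last ring.
  move=> h0 u0 uh.
  have : K * Rabs h * Rabs u <= K * Rabs h * Rabs h.
    by apply: Rmult_le_compat_l => //; nra.
  move=> p q; lra.
have := MVT_abs (fun u => f (x + u) - f1 x * u - f2 x * u ^ 2 / 2)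
   (fun u => f1 (x + u) - f1 x - f2 x * u) 0 h (K * Rabs h ^ 2).
rewrite !Rplus_0_r !Rminus_0_r Rmult_0_r.
rewrite (_ : f2 x * 0 ^ 2 / 2 = 0); last by field.
rewrite !Rminus_0_r.
rewrite (_ : f (x + h) - f1 x * h - f2 x * h ^ 2 / 2 - f x
  = f (x + h) - f x - f1 x * h - f2 x * h ^ 2 / 2); last ring.
rewrite (_ : K * Rabs h ^ 2 * Rabs h = K * Rabs h ^ 3); last ring.
apply=> u hu; split; last exact: B1.
apply: (is_derive_minus (K := R_AbsRing)).
  apply: (is_derive_minus (K := R_AbsRing)); first exact: (shift f f1).
  by auto_derive => //; ring.
by auto_derive => //; field.
Qed.

(** Each derivative is a polynomial in [w = z / sqrt tau] times the density, which is bounded, times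
    at most the fourth power of [1 / sqrt tau]. *)
Lemma heat_derivative_bounds delta : 0 < delta -> exists M, 1 <= M /\
  forall tau z, delta <= tau ->
  Rabs (heat1 tau z) <= M /\ Rabs (heat2 tau z) <= M /\
  Rabs (heat3 tau z) <= M /\ Rabs (heat4 tau z) <= M.
Proof.
move=> d0; have rd0 := sqrt_lt_R0 _ d0.
(* The summand 1 gives [B >= 1], so that [B ^ 4] dominates the lower powers. *)
pose B := 1 + / sqrt delta.
have B0 : 0 < / sqrt delta by apply: Rinv_0_lt_compat.
have B1 : 1 <= B by rewrite /B; lra.
exists (10 * B ^ 4); split; first by have := pow_R1_Rle B 4 B1; lra.
move=> tau z dt.
have t0 : 0 < tau by lra.
have r0 := sqrt_lt_R0 _ t0.
have E : sqrt tau * sqrt tau = tau by apply: sqrt_sqrt; lra.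
have rB : / sqrt tau <= B.
  suff : / sqrt tau <= / sqrt delta by rewrite /B; lra.
  by apply: Rinv_le_contravar => //; apply: sqrt_le_1; lra.
have i0 : 0 < / sqrt tau by apply: Rinv_0_lt_compat.
rewrite /heat1 /heat2 /heat3 /heat4.
have [[p0 p1] p2] := density_bounds (z / sqrt tau).
have p3 := density_cube (z / sqrt tau).
have Ez : z = (z / sqrt tau) * sqrt tau by field; lra.
rewrite {2}Ez; move: (z / sqrt tau) p0 p1 p2 p3 => w {Ez}.
move: (std_normal_density w) => d p0 p1 p2 p3.
move: B B1 rB => {B0 rd0}B B1 rB.
move: (sqrt tau) r0 E i0 rB => r r0 E; rewrite -{}E => i0 rB {t0 dt}.
have -> : - (d / r) = - d * / r by field; lra.
have -> : w * r * d / (r * r * r) = (w * d) * (/ r) ^ 2 by field; lra.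
have -> : (1 - w ^ 2) * d / (r * r * r) = ((1 - w ^ 2) * d) * (/ r) ^ 3 by field; lra.
have -> : (w ^ 3 - 3 * w) * d / (2 * (r * r) ^ 2) = ((w ^ 3 - 3 * w) * d / 2) * (/ r) ^ 4.
  by field; lra.
move: (/ r) i0 rB => q q0 qB {r0 r}.
have main k c : (k <= 4)%N -> Rabs c <= 10 -> Rabs (c * q ^ k) <= 10 * B ^ 4.
  move=> k4 c10; rewrite Rabs_mult.
  have qk0 : 0 <= q ^ k by apply: pow_le; lra.
  apply: Rmult_le_compat => //; try exact: Rabs_pos.
  rewrite Rabs_pos_eq //; apply: (Rle_trans _ (B ^ k)); first by apply: pow_incr; lra.
  by apply: Rle_pow => //; apply/leP.
have wd : Rabs (w * d) <= 5.
  rewrite Rabs_mult (Rabs_pos_eq d); last lra.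
  have := Rabs_pos w; rewrite -(pow2_abs w) in p2; move: (Rabs w) p2 => v p2 v0.
  by have : 0 <= (v - 1) ^ 2 * d; [apply: Rmult_le_pos; [exact: pow2_ge_0 | lra] | lra].
split; last split; last split.
- by rewrite -{1}(pow_1 q); apply: main; [lia | split_Rabs; lra].
- apply: main; [lia | lra].
- apply: main; [lia | ].
  have : 0 <= w ^ 2 * d by apply: Rmult_le_pos; [exact: pow2_ge_0 | lra].
  by split_Rabs; lra.
- apply: main; first lia.
  have : Rabs (w ^ 3 * d) <= 4 by rewrite Rabs_mult -RPow_abs (Rabs_pos_eq d); lra.
  rewrite (_ : (w ^ 3 - 3 * w) * d / 2 = (w ^ 3 * d - 3 * (w * d)) / 2); last by field.
  move: (w ^ 3 * d) (w * d) wd => a b wd a4; split_Rabs; lra.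
Qed.

Lemma heat_estimates delta : 0 < delta -> exists M, 1 <= M /\
  forall tau, delta <= tau ->
  (forall z, Rabs (heat1 tau z) <= M /\ Rabs (heat2 tau z) <= M) /\
  (forall z z', Rabs (heat1 tau z - heat1 tau z') <= M * Rabs (z - z')) /\
  (forall z h, Rabs (heat tau (z + h) - heat tau z - heat1 tau z * h - heat2 tau z * h ^ 2 / 2)
     <= M * Rabs h ^ 3) /\
  (forall z h, 0 <= h ->
     Rabs (heat (tau + h) z - heat tau z - h / 2 * heat2 tau z) <= M * h ^ 2).
Proof.
move=> d0; have [M [M1 H]] := heat_derivative_bounds delta d0.
exists M; split=> // tau dt; have t0 : 0 < tau by lra.
split; [|split; [|split]].
- by move=> z; have [? [? _]] := H tau z dt.
- move=> z z'; apply: (MVT_abs _ (heat2 tau)) => x _; split; first exact: is_derive_heat1_x.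
  by have [_ []] := H tau x dt.
- move=> z h; apply: taylor2 => [x|x|x y]; [exact: is_derive_heat_x|exact: is_derive_heat1_x|].
  apply: (MVT_abs _ (heat3 tau)) => u _; split; first exact: is_derive_heat2_x.
  by have [_ [_ []]] := H tau u dt.
- move=> z h h0.
  (* Removing the linear part leaves a function of [t] whose derivative is at most [M * h] in
     absolute value, since [heat2] is [M]-Lipschitz in [tau]. *)
  have := MVT_abs (fun t => heat t z - (t - tau) / 2 * heat2 tau z)
     (fun t => heat2 t z / 2 - heat2 tau z / 2) tau (tau + h) (M * h).
  rewrite (_ : tau + h - tau = h); last ring.
  rewrite (Rabs_pos_eq h) // (_ : tau - tau = 0); last ring.
  rewrite (_ : heat (tau + h) z - h / 2 * heat2 tau z - (heat tau z - 0 / 2 * heat2 tau z)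
     = heat (tau + h) z - heat tau z - h / 2 * heat2 tau z); last by field.
  rewrite (_ : M * h * h = M * h ^ 2); last ring.
  apply; rewrite Rmin_left ?Rmax_right; try lra.
  move=> x hx; split.
    apply: (is_derive_minus (K := R_AbsRing)); first by apply: is_derive_heat_t; lra.
    by auto_derive => //; field.
  have : Rabs (heat2 x z - heat2 tau z) <= M * Rabs (x - tau).
    apply: (MVT_abs (fun t => heat2 t z) (fun t => heat4 t z)) => u.
    rewrite Rmin_left ?Rmax_right; try lra; move=> hu.
    split; first by apply: is_derive_heat2_t; lra.
    by have [_ [_ []]] := H u z ltac:(lra).
  rewrite (Rabs_pos_eq (x - tau)); last lra.
  have : M * (x - tau) <= M * h by apply: Rmult_le_compat_l; lra.
  have := Rabs_pos (heat2 x z - heat2 tau z).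
  rewrite (_ : heat2 x z / 2 - heat2 tau z / 2 = (heat2 x z - heat2 tau z) / 2); last by field.
  rewrite /Rdiv Rabs_mult (Rabs_pos_eq (/ 2)); lra.
Qed.

Set Implicit Arguments.
Unset Strict Implicit.
Unset Printing Implicit Defensive.
Arguments INR : simpl never.

(** * Appending a value to a permutation *)

HB.instance Definition _ := Monoid.isComLaw.Build R 0 Rplus
  (fun x y z => esym (Rplus_assoc x y z)) Rplus_comm Rplus_0_l.
HB.instance Definition _ := Monoid.isMulLaw.Build R 0 Rmult
  Rmult_0_l Rmult_0_r.
HB.instance Definition _ := Monoid.isAddLaw.Build R Rmult Rplus
  Rmult_plus_distr_r Rmult_plus_distr_l.

Notation "\rsum_ ( i : T ) F" := (\big[Rplus/0]_(i : T) F)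
  (at level 41, F at level 41, i at level 50).
Notation "\rsum_ ( i < n ) F" := (\big[Rplus/0]_(i < n) F)
  (at level 41, F at level 41, i, n at level 50).

Lemma INR_sum (I : finType) (F : I -> nat) :
  INR (\sum_(i : I) F i)%N = \rsum_(i : I) INR (F i).
Proof. exact: (big_morph INR plus_INR (erefl _)). Qed.

Lemma rsum_const (I : finType) (c : R) : \rsum_(i : I) c = INR #|I| * c.
Proof.
rewrite big_const; elim: #|_| => [|n IH]; first by rewrite /= Rmult_0_l.
by rewrite iterS IH S_INR Rmult_plus_distr_r Rmult_1_l Rplus_comm.
Qed.

Lemma rsum_le (I : finType) (F G : I -> R) :
  (forall i, F i <= G i) -> \rsum_(i : I) F i <= \rsum_(i : I) G i.
Proof.
move=> H; apply: (big_ind2 (fun a b => a <= b)) => [|a b c d|i _] //; lra.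
Qed.

Lemma rsum_abs_le (I : finType) (F : I -> R) (M : R) :
  (forall i, Rabs (F i) <= M) -> Rabs (\rsum_(i : I) F i) <= INR #|I| * M.
Proof.
move=> H; rewrite -rsum_const.
apply: (big_ind2 (fun a b => Rabs a <= b)) => [|a b c d ab cd|i _] //.
  rewrite Rabs_R0; lra.
by apply: Rle_trans (Rabs_triang _ _) _; lra.
Qed.

(** The default value of [pval] is never met, because [i < n.-1] keeps [i.+1] in range. *)
Definition desc_sum (wt : nat -> nat) n (p : {perm 'I_n}) : nat :=
  (\sum_(0 <= i < n.-1) (if Defs.pval p i.+1 < Defs.pval p i then wt i else 0))%N.

(** A permutation amounts to its last value [j] and the relative order [s] of the other entries; the
    correspondence is injective between sets of equal size. *)
Lemma rsum_perm_lift n (F : {perm 'I_n.+1} -> R) :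
  \rsum_(p : {perm 'I_n.+1}) F p =
  \rsum_(s : {perm 'I_n}) \rsum_(j < n.+1) F (lift_perm ord_max j s).
Proof.
rewrite pair_big /=.
rewrite (reindex (fun q : {perm 'I_n} * 'I_n.+1 => lift_perm ord_max q.2 q.1)) //=.
apply: onW_bij; apply: inj_card_bij.
  move=> [s j] [s' j'] /= E.
  have Ej : j = j' by move/permP/(_ ord_max): E; rewrite !lift_perm_id.
  subst j'; congr (_, _); apply/permP => k.
  by move/permP/(_ (lift ord_max k)): E; rewrite !lift_perm_lift => /lift_inj.
by rewrite card_prod card_ord !card_Sn factS mulnC.
Qed.

(** Inserting [j] preserves the order of the earlier entries, and the last position forms an
    inversion with exactly the values of [s] that are at least [j]. *)
Lemma inv_perm_lift n (s : {perm 'I_n}) (j : 'I_n.+1) :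
  inv_perm (lift_perm ord_max j s) = (inv_perm s + (n - j))%N.
Proof.
rewrite /inv_perm big_ord_recr /= [X in (_ + X)%N]big1 ?addn0; last first.
  by move=> i _; rewrite ltnNge -ltnS ltn_ord.
have W (i : 'I_n) : widen_ord (leqnSn n) i = lift ord_max i.
  by apply: val_inj; rewrite /= /bump leqNgt ltn_ord.
under eq_bigr => i _.
  rewrite big_ord_recr /= lift_perm_id W lift_perm_lift ltn_ord.
  rewrite [lift j (s i) : nat]/= /bump.
  under eq_bigr => k _.
    rewrite W lift_perm_lift /= /bump.
    rewrite (_ : (_ + s k < _ + s i)%N = (s k < s i)%N); last first.
      lia.
    over.
  over.
rewrite big_split /=; congr (_ + _)%N.
(* Counting by value instead of by position. *)
rewrite (reindex_inj (h := (s^-1)%g)) /=; last exact: perm_inj.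
under eq_bigr => i _.
  rewrite permKV (_ : (j < _)%N = (j <= i)%N); last first.
    by lia.
  over.
rewrite -(big_mkord xpredT (fun i => nat_of_bool (j <= i)%N)).
have jn : (j <= n)%N by rewrite -ltnS.
rewrite (big_cat_nat (n := j)) //= big_nat big1 ?add0n => [|i /andP[_ ij]]; last first.
  by rewrite leqNgt ij.
rewrite big_nat (eq_bigr (fun=> 1%N)) => [|i /andP[-> _] //].
by rewrite -big_nat sum_nat_const_nat muln1.
Qed.

Lemma pval_ord n (p : {perm 'I_n}) (i : 'I_n) : Defs.pval p i = p i.
Proof. by rewrite /Defs.pval valK. Qed.

Lemma pval_last n (p : {perm 'I_n.+1}) : Defs.pval p n = p ord_max.
Proof. exact: (pval_ord p ord_max). Qed.

Lemma pval_lift n (s : {perm 'I_n}) (j : 'I_n.+1) (k : nat) : (k < n)%N ->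
  Defs.pval (lift_perm ord_max j s) k = bump j (Defs.pval s k).
Proof.
move=> kn; rewrite -[k]/(val (Ordinal kn)) pval_ord.
have -> : val (Ordinal kn) = val (lift ord_max (Ordinal kn)).
  by rewrite /= /bump leqNgt kn.
by rewrite pval_ord lift_perm_lift.
Qed.

(** Earlier descents survive since [bump j] is strictly increasing. An old last value equal to [j]
    is bumped above it, so the new descent condition is [j <= s ord_max] and not a strict
    inequality. *)
Lemma desc_sum_lift wt n (s : {perm 'I_n.+1}) (j : 'I_n.+2) :
  desc_sum wt (lift_perm ord_max j s) =
  (desc_sum wt s + (if j <= s ord_max then wt n else 0))%N.
Proof.
rewrite /desc_sum /= big_nat_recr //=; congr (_ + _)%N.
  apply: eq_big_nat => i /andP[_ iN].
  rewrite !pval_lift ?ltnS //; last exact: ltnW.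
  by rewrite /bump (_ : (_ + Defs.pval s i.+1 < _ + Defs.pval s i)%N =
    (Defs.pval s i.+1 < Defs.pval s i)%N) //; lia.
rewrite [Defs.pval _ n]pval_lift //.
rewrite !pval_last lift_perm_id /bump.
by congr (if _ then _ else _); lia.
Qed.

(** * One Lindeberg step *)

Lemma Rabs_add_le a b A B : Rabs a <= A -> Rabs b <= B -> Rabs (a + b) <= A + B.
Proof. by move=> ha hb; apply: Rle_trans (Rabs_triang _ _) _; lra. Qed.

Lemma Rabs_mul_le a b A B : Rabs a <= A -> Rabs b <= B -> Rabs (a * b) <= A * B.
Proof. by move=> ha hb; rewrite Rabs_mult; apply: Rmult_le_compat => //; exact: Rabs_pos. Qed.

Lemma rsum_sub (I : finType) (F G : I -> R) :
  \rsum_(i : I) (F i - G i) = \rsum_(i : I) F i - \rsum_(i : I) G i.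
Proof.
rewrite (eq_bigr (fun i => F i + - 1 * G i)); last by move=> i _; ring.
by rewrite big_split /= -big_distrr /=; ring.
Qed.

Ltac split_abs := repeat first [assumption | apply: Rabs_add_le | apply: Rabs_mul_le].

(** What is discarded from the product of two quadratic expansions has degree at least 3 in the
    increments, and [e <= 1] absorbs it in [e ^ 3]. *)
Lemma product_taylor M e F G A0 A1 A2 B0 B1 B2 xi eta :
  1 <= M -> 0 <= e <= 1 -> Rabs xi <= e -> Rabs eta <= e ->
  Rabs F <= 1 -> Rabs B0 <= 1 ->
  Rabs A1 <= M -> Rabs A2 <= M -> Rabs B1 <= M -> Rabs B2 <= M ->
  Rabs (F - A0 - A1 * xi - A2 * xi ^ 2 / 2) <= M * e ^ 3 ->
  Rabs (G - B0 - B1 * eta - B2 * eta ^ 2 / 2) <= M * e ^ 3 ->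
  Rabs (F * G - (A0 * B0 + A0 * B1 * eta + A1 * B0 * xi + A1 * B1 * (xi * eta)
     + A0 * B2 / 2 * eta ^ 2 + A2 * B0 / 2 * xi ^ 2)) <= 6 * M ^ 2 * e ^ 3.
Proof.
move=> M1 [e0 e1] hx hy hF hB0 hA1 hA2 hB1 hB2 hr hq.
have hx2 : Rabs (xi ^ 2) <= e ^ 2.
  by rewrite -RPow_abs; apply: pow_incr; split=> //; exact: Rabs_pos.
have hy2 : Rabs (eta ^ 2) <= e ^ 2.
  by rewrite -RPow_abs; apply: pow_incr; split=> //; exact: Rabs_pos.
have h2 : Rabs (/ 2) <= / 2 by rewrite Rabs_pos_eq; lra.
have e2 : 0 <= e ^ 2 <= e by nra.
have hQ : Rabs (B0 + B1 * eta + B2 * (eta ^ 2) * / 2) <= 3 * M.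
  apply: (Rle_trans _ (1 + M * e + M * e ^ 2 * / 2)); last nra.
  by split_abs.
(* [F * G] is compared with [F] times the expansion of [G], then with the product of the two
   expansions; the last bracket holds its terms of degree 3 and 4. *)
rewrite (_ : F * G - _ = F * (G - B0 - B1 * eta - B2 * eta ^ 2 / 2)
  + (F - A0 - A1 * xi - A2 * xi ^ 2 / 2) * (B0 + B1 * eta + B2 * (eta ^ 2) * / 2)
  + (A1 * B2 * xi * (eta ^ 2) * / 2 + A2 * B1 * (xi ^ 2) * eta * / 2
     + A2 * B2 * (xi ^ 2) * (eta ^ 2) * / 2 * / 2)); last by field.
apply: (Rle_trans _ (1 * (M * e ^ 3) + M * e ^ 3 * (3 * M)
   + (M * M * e * e ^ 2 * / 2 + M * M * e ^ 2 * e * / 2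
     + M * M * e ^ 2 * e ^ 2 * / 2 * / 2))).
  by split_abs.
have e3 : 0 <= e ^ 3 by apply: pow_le.
have e4 : e ^ 2 * e ^ 2 <= e ^ 3 by have : 0 <= e ^ 3 * (1 - e) by [nra]; lra.
have : M * e ^ 3 <= M * M * e ^ 3 by apply: Rmult_le_compat_r => //; nra.
have : M * M * (e ^ 2 * e ^ 2) <= M * M * e ^ 3 by apply: Rmult_le_compat_l; nra.
have : 0 <= M * M * e ^ 3 by apply: Rmult_le_pos; nra.
lra.
Qed.

(** The kept terms are those of [product_taylor] averaged over centred increments of variance [h],
    except for the covariance term. *)
Lemma product_heat_shift M e h F G A0 A2 B0 B2 :
  1 <= M -> 0 <= e <= 1 -> 0 <= h <= e ^ 2 ->
  Rabs F <= 1 -> Rabs B0 <= 1 -> Rabs A2 <= M -> Rabs B2 <= M ->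
  Rabs (F - A0 - h / 2 * A2) <= M * h ^ 2 ->
  Rabs (G - B0 - h / 2 * B2) <= M * h ^ 2 ->
  Rabs (F * G - (A0 * B0 + A0 * B2 / 2 * h + A2 * B0 / 2 * h)) <= 4 * M ^ 2 * e ^ 3.
Proof.
move=> M1 [e0 e1] [h0 he] hF hB0 hA2 hB2 hr hq.
have hh : Rabs h <= e ^ 2 by rewrite Rabs_pos_eq.
have h2 : Rabs (/ 2) <= / 2 by rewrite Rabs_pos_eq; lra.
have e3 : 0 <= e ^ 3 by apply: pow_le.
have e4 : e ^ 2 * e ^ 2 <= e ^ 3 by have : 0 <= e ^ 3 * (1 - e) by [nra]; lra.
have h3 : M * h ^ 2 <= M * e ^ 3.
  apply: Rmult_le_compat_l; first lra.
  apply: Rle_trans e4; rewrite (_ : h ^ 2 = h * h); last ring.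
  by apply: Rmult_le_compat; lra.
have {}hr := Rle_trans _ _ _ hr h3; have {}hq := Rle_trans _ _ _ hq h3.
rewrite (_ : F * G - _ = F * (G - B0 - h / 2 * B2)
  + (F - A0 - h / 2 * A2) * (B0 + B2 * h * / 2) + A2 * B2 * h * h * / 2 * / 2); last by field.
apply: (Rle_trans _ (1 * (M * e ^ 3) + M * e ^ 3 * (1 + M * e ^ 2 * / 2)
   + M * M * e ^ 2 * e ^ 2 * / 2 * / 2)).
  split_abs; rewrite Rabs_pos_eq; lra.
have : M * e ^ 3 <= M * M * e ^ 3 by apply: Rmult_le_compat_r => //; nra.
have : M * M * (e ^ 2 * e ^ 2) <= M * M * e ^ 3 by apply: Rmult_le_compat_l; nra.
have : M * e ^ 3 * (M * e ^ 2) <= M * e ^ 3 * (M * 1).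
  apply: Rmult_le_compat_l; first by apply: Rmult_le_pos; lra.
  by apply: Rmult_le_compat_l; [lra | nra].
have : 0 <= M * M * e ^ 3 by apply: Rmult_le_pos; nra.
lra.
Qed.

Lemma heat_bounds tau z : Rabs (heat tau z) <= 1.
Proof. by have := Phi_bounds (- z / sqrt tau) => H; rewrite Rabs_pos_eq /heat; lra. Qed.

(** On averaging over [j], centring kills the linear terms, and by the heat equation the squares
    match the shift of [tau] by [h]; only the covariance is left. The estimates on [heat1] are
    exported for [avg_cross], which treats that term. *)
Lemma heat_step delta : 0 < delta -> exists M, 1 <= M /\
  (forall tau, delta <= tau -> forall z, Rabs (heat1 tau z) <= M) /\
  (forall tau, delta <= tau -> forall z z',
     Rabs (heat1 tau z - heat1 tau z') <= M * Rabs (z - z')) /\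
  forall tau (N : nat) (xi eta : 'I_N -> R) (e h x y : R), delta <= tau ->
  (0 < N)%N -> 0 <= e <= 1 -> 0 <= h <= e ^ 2 ->
  (forall j, Rabs (xi j) <= e) -> (forall j, Rabs (eta j) <= e) ->
  \rsum_(j < N) xi j = 0 -> \rsum_(j < N) eta j = 0 ->
  \rsum_(j < N) xi j ^ 2 = INR N * h -> \rsum_(j < N) eta j ^ 2 = INR N * h ->
  Rabs ((\rsum_(j < N) (heat tau (x + xi j) * heat tau (y + eta j))) / INR N
    - heat (tau + h) x * heat (tau + h) y
    - heat1 tau x * heat1 tau y * (\rsum_(j < N) (xi j * eta j)) / INR N)
  <= 10 * M ^ 2 * e ^ 3.
Proof.
move=> d0; have [M [M1 H]] := heat_estimates delta d0; exists M; split=> //.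
split; first by move=> tau /H[B _] z; have [] := B z.
split; first by move=> tau /H[_ [L _]] z z'; exact: L.
move=> tau N xi eta e h x y /H[B [_ [T S]]] N0 e01 h01 hxi heta Sx Sy Sxx Syy.
have N1 : 0 < INR N by apply: lt_0_INR; apply/ltP.
have [A1 A2] := B x; have [B1 B2] := B y.
pose L j := heat tau x * heat tau y + heat tau x * heat1 tau y * eta j
  + heat1 tau x * heat tau y * xi j + heat1 tau x * heat1 tau y * (xi j * eta j)
  + heat tau x * heat2 tau y / 2 * eta j ^ 2 + heat2 tau x * heat tau y / 2 * xi j ^ 2.
have TE z (u : R) : Rabs u <= e ->
  Rabs (heat tau (z + u) - heat tau z - heat1 tau z * u - heat2 tau z * u ^ 2 / 2) <= M * e ^ 3.
  move=> ue; apply: Rle_trans (T z u) _; apply: Rmult_le_compat_l; first lra.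
  by apply: pow_incr; split=> //; exact: Rabs_pos.
have P j : Rabs (heat tau (x + xi j) * heat tau (y + eta j) - L j) <= 6 * M ^ 2 * e ^ 3.
  by apply: product_taylor => //; try (exact: heat_bounds); exact: TE.
have SL : \rsum_(j < N) L j = INR N * (heat tau x * heat tau y + heat tau x * heat2 tau y / 2 * h
   + heat2 tau x * heat tau y / 2 * h) + heat1 tau x * heat1 tau y * \rsum_(j < N) (xi j * eta j).
  rewrite /L !big_split /= rsum_const card_ord -!big_distrr /=.
  by rewrite Sx Sy Sxx Syy; ring.
have D : Rabs (\rsum_(j < N) (heat tau (x + xi j) * heat tau (y + eta j)) - \rsum_(j < N) L j)
    <= INR N * (6 * M ^ 2 * e ^ 3).
  rewrite -rsum_sub; have := rsum_abs_le (I := 'I_N); rewrite card_ord; apply=> j.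
  exact: P.
have Q : Rabs (heat (tau + h) x * heat (tau + h) y -
   (heat tau x * heat tau y + heat tau x * heat2 tau y / 2 * h
    + heat2 tau x * heat tau y / 2 * h)) <= 4 * M ^ 2 * e ^ 3.
  apply: (product_heat_shift (h := h)) => //; try exact: heat_bounds.
    by apply: S; lra.
  by apply: S; lra.
rewrite SL in D.
set Z := \rsum_(j < N) (heat _ _ * heat _ _) in D *.
set c := \rsum_(j < N) (xi j * eta j) in D *.
set W := heat (tau + h) x * heat (tau + h) y in Q *.
rewrite (_ : Z / INR N - W - _ = (Z - (INR N * (heat tau x * heat tau y
    + heat tau x * heat2 tau y / 2 * h + heat2 tau x * heat tau y / 2 * h)
    + heat1 tau x * heat1 tau y * c)) * / INR N
   + - (W - (heat tau x * heat tau y + heat tau x * heat2 tau y / 2 * h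
    + heat2 tau x * heat tau y / 2 * h))); last by field; lra.
rewrite (_ : 10 * M ^ 2 * e ^ 3 = INR N * (6 * M ^ 2 * e ^ 3) * / INR N + 4 * M ^ 2 * e ^ 3);
  last by field; lra.
apply: Rabs_add_le; last by rewrite Rabs_Ropp.
apply: Rabs_mul_le => //; rewrite Rabs_pos_eq; first lra.
by apply: Rlt_le; apply: Rinv_0_lt_compat.
Qed.

(** * The centred processes *)

Definition inv_dev n (p : {perm 'I_n.+1}) : R := INR (inv_perm p) - mean_n n.+1.

(* The descent sum with weights [i + 2] is [maj + des]; with [c = n - p ord_max] the last code
   entry, [maj_dev] is [maj + des - c], centred. *)
Definition maj_dev n (p : {perm 'I_n.+1}) : R :=
  INR (desc_sum (fun i => i.+2) p) + INR (p ord_max) - INR n - mean_n n.+1.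

(* [cyc_diff n v j] is the residue of [j - v - 1] modulo [n + 2]. *)
Definition cyc_diff (n v j : nat) : nat :=
  if (j <= v)%N then (n.+1 + j - v)%N else (j - v.+1)%N.

Lemma inv_dev_lift n (s : {perm 'I_n.+1}) (j : 'I_n.+2) :
  inv_dev (lift_perm ord_max j s) = inv_dev s + (INR n.+1 / 2 - INR j).
Proof.
have jn : (j <= n.+1)%coq_nat by apply/leP; rewrite -ltnS.
rewrite /inv_dev inv_perm_lift plus_INR minus_INR // /mean_n !S_INR; field.
Qed.

(** Up to centring, replacing the last value [v] by [j] changes [maj_dev] by [j - v - 1], and a
    descent adds [n + 2] exactly when [j <= v]: this is reduction modulo [n + 2]. *)
Lemma maj_dev_lift n (s : {perm 'I_n.+1}) (j : 'I_n.+2) :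
  maj_dev (lift_perm ord_max j s)
  = maj_dev s + (INR (cyc_diff n (s ord_max) j) - INR n.+1 / 2).
Proof.
rewrite /maj_dev desc_sum_lift lift_perm_id plus_INR /mean_n /cyc_diff !S_INR.
have := ltn_ord (s ord_max); have := ltn_ord j.
move: (nat_of_ord j) (nat_of_ord (s ord_max)) => a v av vn.
case: leqP => h.
  rewrite (_ : (n.+1 + a - v)%N = (n.+1 - v + a)%N); last lia.
  rewrite plus_INR minus_INR; last lia.
  by rewrite !S_INR; field.
rewrite minus_INR; last lia.
by rewrite S_INR INR_0; field.
Qed.

Lemma cyc_diff_lt n (v j : 'I_n.+2) : (cyc_diff n v j < n.+2)%N.
Proof. by rewrite /cyc_diff; have := ltn_ord v; have := ltn_ord j; case: (leqP j v); lia. Qed.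

(** For fixed [v] the residue runs over all values once as [j] does: given the past, the increment
    of [maj_dev] is uniform up to centring. *)
Lemma rsum_cyc_diff_r n (v : 'I_n.+2) (f : nat -> R) :
  \rsum_(j < n.+2) f (cyc_diff n v j) = \rsum_(j < n.+2) f j.
Proof.
rewrite [RHS](reindex_inj (h := fun j : 'I_n.+2 => Ordinal (cyc_diff_lt v j))) //=.
move=> i j [] /= E; apply: val_inj => /=; move: E (ltn_ord i) (ltn_ord j) (ltn_ord v).
by rewrite /cyc_diff; case: (leqP i v); case: (leqP j v); lia.
Qed.

Lemma rsum_cyc_diff_l n (j : 'I_n.+2) (f : nat -> R) :
  \rsum_(v < n.+2) f (cyc_diff n v j) = \rsum_(v < n.+2) f v.
Proof.
rewrite [RHS](reindex_inj (h := fun v : 'I_n.+2 => Ordinal (cyc_diff_lt v j))) //=.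
move=> i k [] /= E; apply: val_inj => /=; move: E (ltn_ord i) (ltn_ord j) (ltn_ord k).
by rewrite /cyc_diff; case: (leqP j i); case: (leqP j k); lia.
Qed.

Lemma rsum_id N : \rsum_(j < N) INR j = INR N * (INR N - 1) / 2.
Proof.
elim: N => [|N IH]; first by rewrite big_ord0 INR_0; field.
by rewrite big_ord_recr [LHS]/= IH S_INR; field.
Qed.

Lemma rsum_sqr N : \rsum_(j < N) INR j ^ 2 = INR N * (INR N - 1) * (2 * INR N - 1) / 6.
Proof.
elim: N => [|N IH]; first by rewrite big_ord0 INR_0; field.
by rewrite big_ord_recr [LHS]/= -/(INR N ^ 2) IH S_INR; field.
Qed.

Lemma rsum_scal (I : finType) (c : R) (F : I -> R) :
  \rsum_(i : I) (c * F i) = c * \rsum_(i : I) F i.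
Proof. by rewrite big_distrr. Qed.

Lemma rsum_centered N : \rsum_(j < N.+1) (INR j - INR N / 2) = 0.
Proof. by rewrite rsum_sub rsum_id rsum_const card_ord S_INR; field. Qed.

Lemma rsum_centered_sqr N :
  \rsum_(j < N.+1) (INR j - INR N / 2) ^ 2 = INR N.+1 * (INR N * (INR N + 2) / 12).
Proof.
rewrite (eq_bigr (fun j : 'I_N.+1 => INR j ^ 2 - (INR N * INR j - INR N ^ 2 / 4))).
  rewrite !rsum_sub (rsum_scal (INR N)) rsum_sqr rsum_id rsum_const card_ord S_INR.
  by field.
by move=> j _; field.
Qed.

Lemma centered_abs N (j : nat) : (j <= N)%N -> Rabs (INR j - INR N / 2) <= INR N.
Proof.
move=> /leP/le_INR h; have := pos_INR j; split_Rabs; lra.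
Qed.

(* Up to normalisation, the covariance of the two increments given the last value [v]. *)
Definition cross (n v : nat) : R :=
  \rsum_(j < n.+2) ((INR n.+1 / 2 - INR j) * (INR (cyc_diff n v j) - INR n.+1 / 2)).

Lemma cross_bound n (v : 'I_n.+2) : Rabs (cross n v) <= INR n.+2 * INR n.+1 ^ 2.
Proof.
have := rsum_abs_le (I := 'I_n.+2); rewrite card_ord; apply=> j.
rewrite (_ : INR n.+1 ^ 2 = INR n.+1 * INR n.+1); last by rewrite -Rsqr_pow2.
apply: Rabs_mul_le.
  by rewrite Rabs_minus_sym; apply: centered_abs; rewrite -ltnS.
by apply: centered_abs; rewrite -ltnS cyc_diff_lt.
Qed.

(* Over all [n + 2] residues [v] the sum would vanish, so only the missing [v = n + 1] counts. *)
Lemma rsum_cross n :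
  \rsum_(v < n.+1) cross n v = INR n.+2 * (INR n.+1 * (INR n.+1 + 2) / 12).
Proof.
rewrite /cross exchange_big /= -rsum_centered_sqr; apply: eq_bigr => j _.
rewrite -big_distrr /=.
have := rsum_cyc_diff_l j (fun v => INR v - INR n.+1 / 2).
rewrite rsum_centered big_ord_recr /= => E.
have W : cyc_diff n n.+1 j = j by rewrite /cyc_diff -ltnS ltn_ord addnC addnK.
rewrite W in E.
rewrite (_ : \big[_/_]_(i < _) _ = - (INR j - INR n.+1 / 2)); [ring |].
by apply: (Rplus_eq_reg_r (INR j - INR n.+1 / 2)); rewrite E; ring.
Qed.

(** * Averages over the symmetric group *)

Definition avg n (f : {perm 'I_n.+1} -> R) : R :=
  (\rsum_(p : {perm 'I_n.+1}) f p) / INR (n.+1)`!.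

Lemma INR_S_pos n : 0 < INR n.+1.
Proof. by apply: lt_0_INR; lia. Qed.

Lemma INR_fact_pos n : 0 < INR n`!.
Proof. by apply: lt_0_INR; apply/ltP; exact: fact_gt0. Qed.

Lemma eq_avg n (f g : {perm 'I_n.+1} -> R) : f =1 g -> avg f = avg g.
Proof. by move=> fg; congr (_ / _); apply: eq_bigr. Qed.

Lemma avg_abs n (f : {perm 'I_n.+1} -> R) M :
  (forall p, Rabs (f p) <= M) -> Rabs (avg f) <= M.
Proof.
move=> H; have f0 := INR_fact_pos n.+1.
have := rsum_abs_le H; rewrite card_Sn => h.
rewrite /avg Rabs_div; last lra.
rewrite (Rabs_pos_eq (INR _)); last lra.
by apply/(Rle_div_l _ _ _ f0); rewrite Rmult_comm.
Qed.

Lemma avg_sub n (f g : {perm 'I_n.+1} -> R) : avg (fun p => f p - g p) = avg f - avg g.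
Proof. by rewrite /avg rsum_sub; exact: RIneq.Rdiv_minus_distr. Qed.

Lemma avg_le n (f g : {perm 'I_n.+1} -> R) : (forall p, f p <= g p) -> avg f <= avg g.
Proof.
move=> fg; rewrite /avg /Rdiv; apply: Rmult_le_compat_r; last exact: rsum_le.
by apply: Rlt_le; apply: Rinv_0_lt_compat; exact: INR_fact_pos.
Qed.

Lemma avg_scal n c (f : {perm 'I_n.+1} -> R) : avg (fun p => c * f p) = c * avg f.
Proof. by rewrite /avg rsum_scal /Rdiv Rmult_assoc. Qed.

Lemma avg_const n c : avg (fun _ : {perm 'I_n.+1} => c) = c.
Proof.
have f0 := INR_fact_pos n.+1.
by rewrite /avg rsum_const card_Sn; field; lra.
Qed.

Lemma rsum_div (I : finType) (c : R) (F : I -> R) :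
  \rsum_(i : I) (F i / c) = (\rsum_(i : I) F i) / c.
Proof. by rewrite /Rdiv big_distrl. Qed.

(** Conditioning on the relative order [s] of all entries but the last; the last value is uniform
    whatever [s] is. *)
Lemma avg_lift n (f : {perm 'I_n.+2} -> R) :
  avg f = avg (fun s : {perm 'I_n.+1} =>
    (\rsum_(j < n.+2) f (lift_perm ord_max j s)) / INR n.+2).
Proof.
have f0 := INR_fact_pos n.+1; have s0 := INR_S_pos n.+1.
rewrite /avg rsum_perm_lift rsum_div factS mult_INR /Rdiv Rinv_mult.
by rewrite -Rmult_assoc.
Qed.

(* The bound gains a factor over [cross_bound] because the last value of [s] is independent of
   the restriction of [s] to the earlier positions, where [g1] and [g2] are almost unchanged. *)
Lemma avg_cross n sg M g1 g2 x0 y0 : 0 < sg -> 0 <= M ->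
  (forall z, Rabs (g1 z) <= M) -> (forall z, Rabs (g2 z) <= M) ->
  (forall z z', Rabs (g1 z - g1 z') <= M * Rabs (z - z')) ->
  (forall z z', Rabs (g2 z - g2 z') <= M * Rabs (z - z')) ->
  Rabs (avg (fun s : {perm 'I_n.+1} =>
     g1 (x0 + inv_dev s / sg) * g2 (y0 + maj_dev s / sg) * cross n (s ord_max)))
  <= INR n.+2 * sg ^ 2 *
     (2 * M ^ 2 * (INR n.+1 / sg) ^ 3 + M ^ 2 * (INR n.+1 / sg) / sg).
Proof.
move=> s0 M0 B1 B2 L1 L2.
have n1 := INR_S_pos n; have n2 := INR_S_pos n.+1.
set e := INR n.+1 / sg.
have e0 : 0 < e by apply: Rdiv_lt_0_compat.
have es : INR n.+1 = e * sg by rewrite /e; field; lra.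
case: n n1 n2 @e e0 es => [|n] n1 n2 e e0 es.
  (* For [n = 0] there is no earlier position to condition on; the crude bound on [cross] fits in
     the term [M ^ 2 * e / sg] because [e * sg = 1]. *)
  apply: avg_abs => p.
  have p0 : p ord_max = 0%N :> nat by case: (p ord_max) => [[]].
  have cb : Rabs (cross 0 (p ord_max)) <= INR 2 * INR 1 ^ 2.
    by rewrite p0; exact: (cross_bound (ord0 : 'I_2)).
  apply: (Rle_trans _ (M * M * (INR 2 * INR 1 ^ 2))).
    by split_abs; exact: B1 || exact: B2.
  have h : 0 <= sg ^ 2 * (M ^ 2 * e ^ 3).
    apply: Rmult_le_pos; first exact: pow2_ge_0.
    by apply: Rmult_le_pos; [exact: pow2_ge_0 | apply: pow_le; lra].
  rewrite (_ : INR 2 * sg ^ 2 * _ =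
    2 * INR 2 * (sg ^ 2 * (M ^ 2 * e ^ 3)) + INR 2 * M ^ 2 * (e * sg)); last by field; lra.
  rewrite -es; have -> : INR 1 = 1 by []; have -> : INR 2 = 2 by [].
  lra.
rewrite avg_lift; apply: avg_abs => s.
set g := g1 (x0 + inv_dev s / sg) * g2 (y0 + maj_dev s / sg).
pose F (j : 'I_n.+2) := g1 (x0 + inv_dev (lift_perm ord_max j s) / sg)
  * g2 (y0 + maj_dev (lift_perm ord_max j s) / sg) * cross n.+1 j.
rewrite (eq_bigr F); last by move=> j _; rewrite /F lift_perm_id.
(* Deleting the last entry moves each argument by at most [e]; as [g1] and [g2] are [M]-Lipschitz
   and bounded by [M], this costs [2 * M ^ 2 * e] times the crude bound on [cross]. *)
have FE j : Rabs (F j - g * cross n.+1 j) <= 2 * M ^ 2 * e * (INR n.+3 * INR n.+2 ^ 2).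
  rewrite /F inv_dev_lift maj_dev_lift.
  set a1 := g1 _; set a2 := g2 _.
  have step u : Rabs u <= INR n.+1 -> Rabs (u / sg) <= e.
    move=> hu; rewrite /e /Rdiv; apply: Rabs_mul_le.
      by apply: Rle_trans hu _; apply: le_INR; lia.
    by rewrite Rabs_pos_eq; [lra | apply: Rlt_le; exact: Rinv_0_lt_compat].
  have d1 : Rabs (a1 - g1 (x0 + inv_dev s / sg)) <= M * e.
    apply: Rle_trans (L1 _ _) _; apply: Rmult_le_compat_l => //.
    rewrite (_ : _ - _ = (INR n.+1 / 2 - INR j) / sg); last by field; lra.
    by apply: step; rewrite Rabs_minus_sym; apply: centered_abs; rewrite -ltnS.
  have d2 : Rabs (a2 - g2 (y0 + maj_dev s / sg)) <= M * e.
    apply: Rle_trans (L2 _ _) _; apply: Rmult_le_compat_l => //.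
    rewrite (_ : _ - _ = (INR (cyc_diff n (s ord_max) j) - INR n.+1 / 2) / sg); last by field; lra.
    apply: step; apply: centered_abs; rewrite -ltnS.
    exact: (cyc_diff_lt (widen_ord (leqnSn _) (s ord_max)) j).
  rewrite (_ : _ - _ = ((a1 - g1 (x0 + inv_dev s / sg)) * a2
     + g1 (x0 + inv_dev s / sg) * (a2 - g2 (y0 + maj_dev s / sg))) * cross n.+1 j);
    last by rewrite /g; ring.
  rewrite (_ : 2 * M ^ 2 * e = M * e * M + M * (M * e)); last ring.
  have cb : Rabs (cross n.+1 j) <= INR n.+3 * INR n.+2 ^ 2.
    exact: (cross_bound (widen_ord (leqnSn _) j)).
  have b1 : Rabs (g1 (x0 + inv_dev s / sg)) <= M by exact: B1.
  have b2 : Rabs a2 <= M by exact: B2.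
  by split_abs.
have := rsum_abs_le FE; rewrite card_ord rsum_sub rsum_scal rsum_cross => H.
have gM : Rabs g <= M * M by apply: Rabs_mul_le.
(* With [g] frozen, averaging over [j] gives the exact sum of [rsum_cross], one order in [n] below
   [cross_bound]. *)
rewrite (_ : (\rsum_(j < n.+2) F j) / _ = ((\rsum_(j < n.+2) F j)
  - g * (INR n.+3 * (INR n.+2 * (INR n.+2 + 2) / 12))) * / INR n.+2
  + g * (INR n.+3 * ((INR n.+2 + 2) * / 12))); last by field; lra.
have i0 : Rabs (/ INR n.+2) <= / INR n.+2.
  by rewrite Rabs_pos_eq; [lra | apply: Rlt_le; exact: Rinv_0_lt_compat].
have i1 : Rabs (INR n.+3 * ((INR n.+2 + 2) * / 12)) <= INR n.+3 * INR n.+2.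
  have h2 : 1 <= INR n.+2 by rewrite -[1]/(INR 1); apply: le_INR; lia.
  have h0 : 0 <= (INR n.+2 + 2) * / 12 <= INR n.+2 by lra.
  rewrite Rabs_pos_eq; last by apply: Rmult_le_pos; lra.
  by apply: Rmult_le_compat_l; lra.
apply: (Rle_trans _ (INR n.+2 * (2 * M ^ 2 * e * (INR n.+3 * INR n.+2 ^ 2)) * / INR n.+2
    + M * M * (INR n.+3 * INR n.+2))).
  by split_abs.
right; rewrite es; field; split; try lra.
Qed.

(** * The central limit theorem *)

(** A smoothed joint distribution function at the thresholds [- x0] and [- y0]; [tau] is the
    variance of independent Gaussian noise added to each coordinate. *)
Definition joint_heat n (sg tau x0 y0 : R) : R :=
  avg (fun s : {perm 'I_n.+1} =>
    heat tau (x0 + inv_dev s / sg) * heat tau (y0 + maj_dev s / sg)).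

(** Trades the last increments for Gaussian noise of the same variance, that of a uniform variable
    on [n.+2] points. The constant is 10 from [heat_step] plus 2 from [avg_cross]. *)
Lemma joint_heat_step delta : 0 < delta -> exists M, 1 <= M /\
  forall n sg tau x0 y0, 0 < sg -> delta <= tau -> INR n.+1 / sg <= 1 ->
  Rabs (joint_heat n.+1 sg tau x0 y0
    - joint_heat n sg (tau + INR n.+1 * (INR n.+1 + 2) / 12 / sg ^ 2) x0 y0)
  <= 12 * M ^ 2 * (INR n.+1 / sg) ^ 3 + M ^ 2 * (INR n.+1 / sg) / sg.
Proof.
move=> d0; have [M [M1 [B [L H]]]] := heat_step d0; exists M; split=> //.
move=> n sg tau x0 y0 s0 dt; set e := INR n.+1 / sg => e1.
set h := _ / sg ^ 2.
have n1 := INR_S_pos n; have n2 := INR_S_pos n.+1.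
have n1' : 1 <= INR n.+1 by rewrite -[1]/(INR 1); apply: le_INR; lia.
have e0 : 0 < e by apply: Rdiv_lt_0_compat.
have es : INR n.+1 = e * sg by rewrite /e; field; lra.
have sg2 : 0 < sg ^ 2 by apply: pow_lt.
have eh : 0 <= h <= e ^ 2.
  rewrite /h; split; first by apply: Rlt_le; apply: Rdiv_lt_0_compat => //; nra.
  apply/(Rle_div_l _ _ _ sg2).
  by rewrite (_ : e ^ 2 * sg ^ 2 = INR n.+1 ^ 2); [nra | rewrite es; ring].
have hs : INR n.+1 * (INR n.+1 + 2) / 12 = h * sg ^ 2 by rewrite /h; field; lra.
have small u : Rabs u <= INR n.+1 -> Rabs (u / sg) <= e.
  move=> hu; rewrite /e /Rdiv; apply: Rabs_mul_le => //.
  by rewrite Rabs_pos_eq; [lra | apply: Rlt_le; exact: Rinv_0_lt_compat].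
(* [INR n.+2] comes from averaging over [j], and [sg ^ 2] from normalising both increments. *)
pose c := / (INR n.+2 * sg ^ 2).
have c0 : 0 < c by apply: Rinv_0_lt_compat; apply: Rmult_lt_0_compat.
pose C (s : {perm 'I_n.+1}) := heat1 tau (x0 + inv_dev s / sg) *
  heat1 tau (y0 + maj_dev s / sg) * cross n (s ord_max).
have main (s : {perm 'I_n.+1}) : Rabs ((\rsum_(j < n.+2)
     (heat tau (x0 + inv_dev (lift_perm ord_max j s) / sg) *
      heat tau (y0 + maj_dev (lift_perm ord_max j s) / sg))) / INR n.+2
   - heat (tau + h) (x0 + inv_dev s / sg) * heat (tau + h) (y0 + maj_dev s / sg)
   - c * C s) <= 10 * M ^ 2 * e ^ 3.
  pose v : 'I_n.+2 := widen_ord (leqnSn _) (s ord_max).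
  pose xi (j : 'I_n.+2) := (INR n.+1 / 2 - INR j) / sg.
  pose eta (j : 'I_n.+2) := (INR (cyc_diff n v j) - INR n.+1 / 2) / sg.
  rewrite (eq_bigr (fun j => heat tau (x0 + inv_dev s / sg + xi j) *
      heat tau (y0 + maj_dev s / sg + eta j))); last first.
    move=> j _; rewrite inv_dev_lift maj_dev_lift -[nat_of_ord (s ord_max)]/(nat_of_ord v).
    by congr (heat _ _ * heat _ _); rewrite /xi /eta; field; lra.
  have Sxe : \rsum_(j < n.+2) (xi j * eta j) = cross n (s ord_max) / sg ^ 2.
    rewrite /cross -rsum_div -[nat_of_ord (s ord_max)]/(nat_of_ord v).
    by apply: eq_bigr => j _; rewrite /xi /eta; field; lra.
  have -> : c * C s = heat1 tau (x0 + inv_dev s / sg) * heat1 tau (y0 + maj_dev s / sg) *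
     (\rsum_(j < n.+2) (xi j * eta j)) / INR n.+2.
    by rewrite Sxe /c /C; field; lra.
  apply: H => //; first lra.
  - move=> j; apply: small; rewrite Rabs_minus_sym; apply: centered_abs; by rewrite -ltnS.
  - move=> j; apply: small; apply: centered_abs; rewrite -ltnS; exact: cyc_diff_lt.
  - rewrite (eq_bigr (fun j : 'I_n.+2 => - / sg * (INR j - INR n.+1 / 2))).
      by rewrite rsum_scal rsum_centered Rmult_0_r.
    by move=> j _; rewrite /xi; field; lra.
  - by rewrite rsum_div (rsum_cyc_diff_r v (fun j => INR j - INR n.+1 / 2))
      rsum_centered /Rdiv Rmult_0_l.
  - rewrite (eq_bigr (fun j : 'I_n.+2 => / sg ^ 2 * (INR j - INR n.+1 / 2) ^ 2)).
      by rewrite rsum_scal rsum_centered_sqr hs; field; lra.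
    by move=> j _; rewrite /xi; field; lra.
  - rewrite (eq_bigr (fun j : 'I_n.+2 => / sg ^ 2 * (INR (cyc_diff n v j) - INR n.+1 / 2) ^ 2)).
      rewrite rsum_scal (rsum_cyc_diff_r v (fun j => (INR j - INR n.+1 / 2) ^ 2)).
      by rewrite rsum_centered_sqr hs; field; lra.
    by move=> j _; rewrite /eta; field; lra.
have := avg_abs main; rewrite avg_sub avg_sub avg_scal.
rewrite -[X in Rabs (X - _ - _)](avg_lift (fun s : {perm 'I_n.+2} =>
  heat tau (x0 + inv_dev s / sg) * heat tau (y0 + maj_dev s / sg))).
rewrite -/(joint_heat n.+1 sg tau x0 y0) -/(joint_heat n sg (tau + h) x0 y0) => main'.
have M0 : 0 <= M by lra.
have := avg_cross n x0 y0 s0 M0 (B _ dt) (B _ dt) (L _ dt) (L _ dt).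
rewrite -/C -/e => K.
have K' : Rabs (c * avg C) <= 2 * M ^ 2 * e ^ 3 + M ^ 2 * e / sg.
  rewrite Rabs_mult (Rabs_pos_eq c); last lra.
  rewrite (_ : 2 * M ^ 2 * e ^ 3 + M ^ 2 * e / sg =
    c * (INR n.+2 * sg ^ 2 * (2 * M ^ 2 * e ^ 3 + M ^ 2 * e / sg))).
    by apply: Rmult_le_compat_l => //; lra.
  by rewrite /c; field; lra.
rewrite (_ : _ - _ = (joint_heat n.+1 sg tau x0 y0 - joint_heat n sg (tau + h) x0 y0
  - c * avg C) + c * avg C); last ring.
by apply: Rle_trans (Rabs_add_le main' K') _; lra.
Qed.

(** * The variance and its growth *)

Definition var_n (n : nat) : R := (2 * INR n ^ 3 + 3 * INR n ^ 2 - 5 * INR n) / 72.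

Lemma var_n_step n : var_n n.+2 = var_n n.+1 + INR n.+1 * (INR n.+1 + 2) / 12.
Proof. by rewrite /var_n !S_INR; field. Qed.

Lemma var_n_le n m : (0 < n <= m)%N -> var_n n <= var_n m.
Proof.
move=> /andP[n0 nm].
have h1 : 1 <= INR n by rewrite -[1]/(INR 1); apply: le_INR; lia.
have h2 : INR n <= INR m by apply: le_INR; lia.
rewrite /var_n; move: (INR n) (INR m) h1 h2 => a b h1 h2.
have : 0 <= (b - a) * (2 * (a * a + a * b + b * b) + 3 * (a + b) - 5).
  by apply: Rmult_le_pos; nra.
lra.
Qed.

Lemma var_n_ge n : (1 < n)%N -> INR n ^ 3 / 36 <= var_n n.
Proof.
move=> n1; have : 2 <= INR n by rewrite -[2]/(INR 2); apply: le_INR; lia.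
by rewrite /var_n; nra.
Qed.

Lemma sigma_n_pos n : (1 < n)%N -> 0 < sigma_n n.
Proof.
move=> n1; apply: sqrt_lt_R0; have := var_n_ge n1; rewrite /var_n.
have : 0 < INR n ^ 3 by apply: pow_lt; apply: lt_0_INR; lia.
lra.
Qed.

Lemma sigma_n_sqr n : (1 < n)%N -> sigma_n n ^ 2 = var_n n.
Proof.
move=> n1; rewrite /= Rmult_1_r; apply: sqrt_sqrt; have := var_n_ge n1; rewrite /var_n.
have : 0 < INR n ^ 3 by apply: pow_lt; apply: lt_0_INR; lia.
lra.
Qed.

(** The small parameter of the limit: it bounds the normalised increments and the error of replacing
    [Yn] by the normalised [maj_dev]. *)
Definition ratio (n : nat) : R := INR n / sigma_n n.

Lemma ratio_pos n : (1 < n)%N -> 0 < ratio n.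
Proof.
by move=> n1; apply: Rdiv_lt_0_compat; [apply: lt_0_INR; lia | exact: sigma_n_pos].
Qed.

Lemma ratio_sqr n : (1 < n)%N -> INR n * ratio n ^ 2 <= 36.
Proof.
move=> n1; have s0 := sigma_n_pos n1; have v := var_n_ge n1.
have s2 := sigma_n_sqr n1.
have n0 : 0 < INR n by apply: lt_0_INR; lia.
have -> : INR n * ratio n ^ 2 = INR n ^ 3 / sigma_n n ^ 2 by rewrite /ratio; field; lra.
have : 0 < INR n ^ 3 by apply: pow_lt.
by rewrite s2 => p; apply/Rle_div_l; lra.
Qed.

Lemma ratio_lim eps : 0 < eps -> exists N, forall n, (N <= n)%N -> (1 < n)%N /\ ratio n < eps.
Proof.
move=> e0; have [N HN] := INR_unbounded (36 / eps ^ 2).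
exists (maxn N 2) => n; rewrite geq_max => /andP[Nn n1]; split=> //.
have r0 := ratio_pos n1; have r2 := ratio_sqr n1.
have hn : INR N <= INR n by apply: le_INR; lia.
have e2 : 0 < eps ^ 2 by apply: pow_lt.
have h : 36 < INR n * eps ^ 2 by apply/(Rlt_div_l _ _ _ e2); lra.
have n0 : 0 < INR n by apply: lt_0_INR; lia.
case: (Rlt_le_dec (ratio n) eps) => // le.
have : eps ^ 2 <= ratio n ^ 2 by apply: pow_incr; lra.
nra.
Qed.

Lemma inv_dev_0 (p : {perm 'I_1}) : inv_dev p = 0.
Proof.
rewrite /inv_dev /inv_perm big_ord1 big_ord1 ltnn /= /mean_n INR_0 INR_1.
by field.
Qed.

Lemma maj_dev_0 (p : {perm 'I_1}) : maj_dev p = 0.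
Proof.
rewrite /maj_dev /desc_sum big_nil.
have -> : p ord_max = 0%N :> nat by case: (p ord_max) => [[]].
by rewrite /mean_n INR_0 INR_1; field.
Qed.

(** Telescoping of [joint_heat_step] from permutations of one point, where both deviations are 0.
    The accumulated error is of order [ratio n.+1] because [ratio_sqr] controls the sum of the cubic
    errors. *)
Lemma joint_heat_limit delta x0 y0 : 0 < delta -> exists K, 0 < K /\
  forall n, (0 < n)%N -> ratio n.+1 <= 1 ->
  Rabs (joint_heat n (sigma_n n.+1) delta x0 y0
    - heat (1 + delta) x0 * heat (1 + delta) y0) <= K * ratio n.+1.
Proof.
move=> d0; have [M [M1 H]] := joint_heat_step d0.
(* [433 = 12 * 36 + 1], with 36 from [ratio_sqr] and 1 from the terms [M ^ 2 * r / sg]. *)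
exists (433 * M ^ 2); split; first nra.
move=> N N1 r1; set r := ratio N.+1; set sg := sigma_n N.+1.
have s0 : 0 < sg by exact: sigma_n_pos.
have r0 : 0 < r by exact: ratio_pos.
have s2 : sg ^ 2 = var_n N.+1 by exact: sigma_n_sqr.
have r2 : INR N.+1 * r ^ 2 <= 36 by exact: ratio_sqr.
pose K := 12 * M ^ 2 * r ^ 3 + M ^ 2 * r / sg.
(* The smoothing [delta] plus the variance of the increments still to come; it falls from
   [1 + delta] at 0 to [delta] at [N]. *)
pose tau n := delta + 1 - var_n n.+1 / sg ^ 2.
have sg2 : 0 < sg ^ 2 by apply: pow_lt.
have M2 : 0 <= M ^ 2 by exact: pow2_ge_0.
have iter n : (n <= N)%N ->
  Rabs (joint_heat n sg (tau n) x0 y0 - heat (1 + delta) x0 * heat (1 + delta) y0) <= INR n * K.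
  elim: n => [_|n IH nN].
    rewrite /joint_heat (eq_avg (g := fun _ => heat (1 + delta) x0 * heat (1 + delta) y0)).
      by rewrite avg_const Rminus_diag Rabs_R0 INR_0; lra.
    move=> p; rewrite inv_dev_0 maj_dev_0 (_ : tau 0%N = 1 + delta).
      by rewrite /Rdiv Rmult_0_l !Rplus_0_r.
    by rewrite /tau /var_n INR_1; field; lra.
  have er : INR n.+1 / sg <= r.
    apply: Rmult_le_compat_r; first by apply: Rlt_le; exact: Rinv_0_lt_compat.
    by apply: le_INR; lia.
  have dt : delta <= tau n.+1.
    have : var_n n.+2 / sg ^ 2 <= 1.
      by apply/(Rle_div_l _ _ _ sg2); rewrite s2 Rmult_1_l; apply: var_n_le.
    by rewrite /tau; lra.
  have := H n sg (tau n.+1) x0 y0 s0 dt (Rle_trans _ _ _ er r1).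
  rewrite (_ : tau n.+1 + _ = tau n); last by rewrite /tau var_n_step; field; lra.
  move=> S.
  rewrite (_ : _ - _ = (joint_heat n.+1 sg (tau n.+1) x0 y0 - joint_heat n sg (tau n) x0 y0)
    + (joint_heat n sg (tau n) x0 y0 - heat (1 + delta) x0 * heat (1 + delta) y0)); last ring.
  rewrite S_INR (_ : (INR n + 1) * K = K + INR n * K); last ring.
  apply: Rabs_add_le; last by apply: IH; lia.
  apply: Rle_trans S _; have e0 : 0 <= INR n.+1 / sg.
    by apply: Rlt_le; apply: Rdiv_lt_0_compat => //; exact: INR_S_pos.
  apply: Rplus_le_compat.
    by apply: Rmult_le_compat_l; [lra | apply: pow_incr].
  apply: Rmult_le_compat_r; first by apply: Rlt_le; exact: Rinv_0_lt_compat.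
  by apply: Rmult_le_compat_l.
have := iter N (leqnn _).
rewrite (_ : tau N = delta); last by rewrite /tau -s2; field; lra.
move=> T; apply: Rle_trans T _.
have K0 : 0 <= K.
  apply: Rplus_le_le_0_compat; first by apply: Rmult_le_pos; [lra | apply: pow_le; lra].
  by apply: Rmult_le_pos; [apply: Rmult_le_pos; lra | apply: Rlt_le; exact: Rinv_0_lt_compat].
apply: (Rle_trans _ (INR N.+1 * K)).
  by apply: Rmult_le_compat_r => //; apply: le_INR; lia.
rewrite (_ : INR N.+1 * K = 12 * M ^ 2 * r * (INR N.+1 * r ^ 2) + M ^ 2 * r * r).
  have a0 : 0 <= M ^ 2 * r by apply: Rmult_le_pos; lra.
  have : M ^ 2 * r * (INR N.+1 * r ^ 2) <= M ^ 2 * r * 36 by apply: Rmult_le_compat_l.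
  have : M ^ 2 * r * r <= M ^ 2 * r * 1 by apply: Rmult_le_compat_l.
  lra.
have es : INR N.+1 = r * sg by rewrite /r /ratio -/sg; field; lra.
by rewrite /K es; field; lra.
Qed.

(** * From smoothed indicators back to the joint distribution function *)

Definition indic (b : bool) : R := if b then 1 else 0.

Lemma joint_prob_avg n s t :
  joint_prob n.+1 s t = avg (fun p : {perm 'I_n.+1} => indic (Rleb (Xn p) s && Rleb (Yn p) t)).
Proof.
rewrite /joint_prob /avg card_Sn; congr (_ / _).
rewrite -sum1dep_card big_mkcond /= INR_sum; apply: eq_bigr => p _.
by rewrite /indic; case: ifP.
Qed.

Lemma RlebP x y : reflect (x <= y) (Rleb x y).
Proof. by rewrite /Rleb; case: Rle_dec => h; constructor. Qed.

Lemma desc_sum_maj n (p : {perm 'I_n.+1}) :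
  (maj_perm p <= desc_sum (fun i => i.+2) p <= maj_perm p + n)%N.
Proof.
rewrite /maj_perm /desc_sum; apply/andP; split.
  by apply: leq_sum => i _; case: ifP.
rewrite [X in (_ + X)%N](_ : n = (\sum_(0 <= i < n.+1.-1) 1)%N).
  by rewrite -big_split /=; apply: leq_sum => i _; case: ifP => //; rewrite addn1.
by rewrite sum_nat_const_nat subn0 muln1.
Qed.

(** Before normalisation the difference is [n - p ord_max] minus the number of descents, and both
    lie between 0 and [n]. *)
Lemma Yn_approx n (p : {perm 'I_n.+1}) : (0 < n)%N ->
  Rabs (Yn p - maj_dev p / sigma_n n.+1) <= ratio n.+1.
Proof.
move=> n0; have s0 : 0 < sigma_n n.+1 by exact: sigma_n_pos.
have /andP[/leP/le_INR h1 /leP/le_INR] := desc_sum_maj p; rewrite plus_INR => h2.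
have h3 : INR (p ord_max) <= INR n by apply: le_INR; apply/leP; rewrite -ltnS.
have h4 := pos_INR (p ord_max).
rewrite (_ : _ - _ = (INR (maj_perm p) - (INR (desc_sum (fun i => i.+2) p)
   + INR (p ord_max) - INR n)) / sigma_n n.+1); last by rewrite /Yn /maj_dev; field; lra.
rewrite Rabs_div; last lra.
rewrite (Rabs_pos_eq (sigma_n _)); last lra.
apply: Rmult_le_compat_r; first by apply: Rlt_le; exact: Rinv_0_lt_compat.
by rewrite S_INR; split_Rabs; lra.
Qed.

(** Raising the threshold by [2 * eps] leaves a margin [eps] once [y] is replaced by [y']: if
    [y <= t], the smoothed indicator is at least [Phi (eps / sqrt delta)]. *)
Lemma indic_le_heat eps delta t y y' : 0 < delta -> Rabs (y - y') <= eps ->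
  indic (Rleb y t) <= heat delta (- (t + 2 * eps) + y') + Phi (- (eps / sqrt delta)).
Proof.
move=> /sqrt_lt_R0 d0 hy; rewrite /indic /heat Phi_opp.
have := Phi_bounds (- (- (t + 2 * eps) + y') / sqrt delta).
have := Phi_bounds (eps / sqrt delta).
case: RlebP => h; last lra.
have : Phi (eps / sqrt delta) <= Phi (- (- (t + 2 * eps) + y') / sqrt delta).
  apply: Phi_le; apply: Rmult_le_compat_r; first by apply: Rlt_le; exact: Rinv_0_lt_compat.
  by move: hy; split_Rabs; lra.
lra.
Qed.

Lemma heat_le_indic eps delta t y y' : 0 < delta -> Rabs (y - y') <= eps ->
  heat delta (- (t - 2 * eps) + y') <= indic (Rleb y t) + Phi (- (eps / sqrt delta)).
Proof.
move=> /sqrt_lt_R0 d0 hy; rewrite /indic /heat.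
have := Phi_bounds (- (- (t - 2 * eps) + y') / sqrt delta).
have := Phi_bounds (- (eps / sqrt delta)).
case: RlebP => h; first lra.
have : Phi (- (- (t - 2 * eps) + y') / sqrt delta) <= Phi (- (eps / sqrt delta)).
  apply: Phi_le; rewrite -Ropp_div; apply: Rmult_le_compat_r.
    by apply: Rlt_le; exact: Rinv_0_lt_compat.
  by move: hy; split_Rabs; lra.
lra.
Qed.

Lemma indic_bounds b : 0 <= indic b <= 1.
Proof. by case: b => /=; lra. Qed.

Lemma indic_and a b : indic (a && b) = indic a * indic b.
Proof. by case: a; case: b => /=; rewrite /indic; lra. Qed.

Lemma mult_le_add a b a' b' k : 0 <= a <= 1 -> 0 <= b' <= 1 -> 0 <= k ->
  a <= a' + k -> b <= b' + k -> a * b <= a' * b' + 2 * k.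
Proof. move=> ha hb k0 h1 h2; nra. Qed.

(** [1 / sqrt (1 + delta)] lies between [1 - delta] and 1, and [Phi] is 1-Lipschitz. *)
Lemma heat_1_approx eps delta s : 0 < delta <= eps ->
  Rabs (heat (1 + delta) (- s) - Phi s) <= Rabs s * eps.
Proof.
move=> de; rewrite /heat Ropp_involutive; apply: Rle_trans (Phi_lipschitz _ _) _.
have r1 : 1 <= sqrt (1 + delta) by rewrite -{1}sqrt_1; apply: sqrt_le_1; lra.
have rr : sqrt (1 + delta) * sqrt (1 + delta) = 1 + delta by apply: sqrt_sqrt; lra.
move: (sqrt _) r1 rr => r r1 rr.
have i1 : / r <= 1 by rewrite -Rinv_1; apply: Rinv_le_contravar; lra.
have i2 : 1 - delta <= / r.
  apply: (Rmult_le_reg_r r); first lra.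
  rewrite Rinv_l; last lra.
  nra.
rewrite (_ : s / r - s = s * (/ r - 1)); last by field; lra.
apply: Rabs_mul_le; [lra | split_Rabs; lra].
Qed.

(** Up to [2 * k], the probability lies between two smoothed joint distribution functions with
    thresholds shifted by [2 * eps] either way, and these converge to values near
    [Phi s * Phi t]. *)
Lemma joint_prob_cvg s t : Un_cv (fun n => joint_prob n s t) (Phi s * Phi t).
Proof.
move=> eta eta0.
have [A [A0 HA]] := Phi_lim (eta / 8) ltac:(lra).
pose c := Rabs s + Rabs t + 8.
have c0 : 8 <= c by have := Rabs_pos s; have := Rabs_pos t; rewrite /c; lra.
(* The three bounds ensure, in turn, threshold shifts of at most 1, an error at most [eta / 4] in
   [prod], and [A <= / eps]. *)
pose eps := Rmin (1 / 2) (Rmin (eta / (4 * c)) (/ A)).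
have ec0 : 0 < eta / (4 * c) by apply: Rdiv_lt_0_compat; lra.
have iA0 : 0 < / A by exact: Rinv_0_lt_compat.
have e0 : 0 < eps by rewrite /eps; do !apply: Rmin_glb_lt => //; lra.
have e1 : eps <= 1 / 2 by exact: Rmin_l.
have ec : eps * c <= eta / 4.
  have : eps <= eta / (4 * c) by apply: Rle_trans (Rmin_r _ _) _; exact: Rmin_l.
  move=> h; apply: (Rle_trans _ (eta / (4 * c) * c)).
    by apply: Rmult_le_compat_r; lra.
  by right; field; lra.
have eA : A <= / eps.
  have : eps <= / A by apply: Rle_trans (Rmin_r _ _) _; exact: Rmin_r.
  by move=> h; rewrite -(Rinv_inv A); apply: Rinv_le_contravar.
(* The fourth power gives [eps / sqrt delta = / eps], hence at least [A]: the smoothing is much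
   finer than the threshold shift. *)
pose delta := eps ^ 4.
have d0 : 0 < delta by exact: pow_lt.
have d1 : delta <= eps.
  rewrite /delta (_ : eps ^ 4 = eps * (eps * eps * eps)); last ring.
  have : eps * eps * eps <= 1 by nra.
  by have := Rmult_lt_0_compat _ _ e0 e0; nra.
have sd : sqrt delta = eps ^ 2.
  by rewrite /delta (_ : eps ^ 4 = (eps ^ 2) ^ 2); [rewrite sqrt_pow2 //; exact: pow2_ge_0 | ring].
have k1 : Phi (- (eps / sqrt delta)) < eta / 8.
  rewrite sd (_ : eps / eps ^ 2 = / eps); last by field; lra.
  exact: HA.
have k0 : 0 <= Phi (- (eps / sqrt delta)) by have := Phi_bounds (- (eps / sqrt delta)); lra.
set k := Phi _ in k0 k1.
have [K1 [K10 H1]] := joint_heat_limit (- (s + 2 * eps)) (- (t + 2 * eps)) d0.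
have [K2 [K20 H2]] := joint_heat_limit (- (s - 2 * eps)) (- (t - 2 * eps)) d0.
have [N HN] : exists N, forall n, (N <= n)%N ->
    [/\ (1 < n)%N, ratio n < eps, K1 * ratio n < eta / 4 & K2 * ratio n < eta / 4].
  have [N1 HN1] := ratio_lim e0.
  have [N2 HN2] := @ratio_lim (eta / 4 / K1) ltac:(apply: Rdiv_lt_0_compat; lra).
  have [N3 HN3] := @ratio_lim (eta / 4 / K2) ltac:(apply: Rdiv_lt_0_compat; lra).
  exists (maxn N1 (maxn N2 N3)) => n; rewrite !geq_max => /and3P[/HN1[n1 h1] /HN2[_ h2] /HN3[_ h3]].
  split=> //.
    by move/(Rlt_div_r _ _ _ K10): h2; lra.
  by move/(Rlt_div_r _ _ _ K20): h3; lra.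
exists N => n /leP/HN[]; case: n => // n n1 re r1 r2.
have rl1 : ratio n.+1 <= 1 by lra.
have {}H1 := H1 n n1 rl1; have {}H2 := H2 n n1 rl1.
have approx u eps' : Rabs eps' <= 2 * eps ->
    Rabs (heat (1 + delta) (- (u + eps')) - Phi u) <= (Rabs u + 4) * eps.
  move=> he; have a1 := heat_1_approx (u + eps') (conj d0 d1).
  have a2 := Phi_lipschitz (u + eps') u.
  have a3 : Rabs (u + eps') * eps <= (Rabs u + 1) * eps.
    by apply: Rmult_le_compat_r; [lra | apply: Rabs_add_le; lra].
  rewrite (_ : _ - _ = (heat (1 + delta) (- (u + eps')) - Phi (u + eps'))
    + (Phi (u + eps') - Phi u)); last ring.
  apply: Rle_trans (Rabs_triang _ _) _.
  rewrite (_ : u + eps' - u = eps') in a2; last ring.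
  lra.
have prod a b a' b' : 0 <= a <= 1 -> 0 <= b' <= 1 ->
    Rabs (a - a') <= (Rabs s + 4) * eps -> Rabs (b - b') <= (Rabs t + 4) * eps ->
    Rabs (a * b - a' * b') <= eta / 4.
  move=> ha hb h1 h2; rewrite (_ : _ - _ = a * (b - b') + (a - a') * b'); last ring.
  apply: (Rle_trans _ (1 * ((Rabs t + 4) * eps) + (Rabs s + 4) * eps * 1)).
    by split_abs; rewrite Rabs_pos_eq; lra.
  by move: ec; rewrite /c; lra.
have heat01 tau z : 0 <= heat tau z <= 1 by exact: Phi_bounds.
have absp : Rabs (2 * eps) <= 2 * eps by rewrite Rabs_pos_eq; lra.
have absm : Rabs (- (2 * eps)) <= 2 * eps by rewrite Rabs_Ropp.
have E1 := prod _ _ _ _ (heat01 _ _) (Phi_bounds t) (approx s _ absp) (approx t _ absp).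
have E2 := prod _ _ _ _ (heat01 _ _) (Phi_bounds t) (approx s _ absm) (approx t _ absm).
have Yapp (p : {perm 'I_n.+1}) : Rabs (Yn p - maj_dev p / sigma_n n.+1) <= eps.
  by have := Yn_approx p n1; lra.
have U : joint_prob n.+1 s t <=
    joint_heat n (sigma_n n.+1) delta (- (s + 2 * eps)) (- (t + 2 * eps)) + 2 * k.
    have := @avg_le n (fun p => indic (Rleb (Xn p) s && Rleb (Yn p) t) -
     heat delta (- (s + 2 * eps) + inv_dev p / sigma_n n.+1)
     * heat delta (- (t + 2 * eps) + maj_dev p / sigma_n n.+1)) (fun _ => 2 * k).
  rewrite avg_const avg_sub -joint_prob_avg => le;
  rewrite Rplus_comm; apply/Rle_minus_l; apply: le => p.
  apply/Rle_minus_l; rewrite (Rplus_comm (2 * k)) indic_and;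
  apply: mult_le_add => //; first exact: indic_bounds.
    (* The first coordinate carries no error: [Xn p] is [inv_dev p / sigma_n n.+1] by definition. *)
    by apply: indic_le_heat => //; rewrite Rminus_diag Rabs_R0; lra.
  exact: indic_le_heat.
have L : joint_heat n (sigma_n n.+1) delta (- (s - 2 * eps)) (- (t - 2 * eps)) <=
    joint_prob n.+1 s t + 2 * k.
  have := @avg_le n (fun p => heat delta (- (s - 2 * eps) + inv_dev p / sigma_n n.+1)
     * heat delta (- (t - 2 * eps) + maj_dev p / sigma_n n.+1)
     - indic (Rleb (Xn p) s && Rleb (Yn p) t)) (fun _ => 2 * k).
  rewrite avg_const avg_sub -joint_prob_avg => le;
  rewrite Rplus_comm; apply/Rle_minus_l; apply: le => p.
  apply/Rle_minus_l; rewrite (Rplus_comm (2 * k)) indic_and;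
  apply: mult_le_add => //; first exact: indic_bounds.
    by apply: heat_le_indic => //; rewrite Rminus_diag Rabs_R0; lra.
  exact: heat_le_indic.
rewrite /R_dist; move: H1 H2 E1 E2 U L; rewrite -/(s - 2 * eps) -/(t - 2 * eps).
set P := joint_prob _ _ _; set h1 := heat _ _ * heat _ _; set h2 := heat _ _ * heat _ _.
set J1 := joint_heat _ _ _ _ _; set J2 := joint_heat _ _ _ _ _.
(* On each side the errors from [joint_heat_limit], from [prod] and from [2 * k] are at most
   [eta / 4] each. *)
by move: P h1 h2 J1 J2 => P h1 h2 J1 J2; split_Rabs; lra.
Qed.

Theorem mainTheorem1 (s t Phis Phit : R) :
  is_std_normal_cdf s Phis -> is_std_normal_cdf t Phit ->
  Un_cv (fun n : nat => joint_prob n s t) (Rmult Phis Phit).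
Proof.
by move=> /std_normal_cdf_Phi -> /std_normal_cdf_Phi ->; exact: joint_prob_cvg.
Qed.
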